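(* Let $(\overline{x},\overline{\lambda})$ be a KKT point of the unperturbed problem, i.e. $(\overline{x},\overline{\lambda})\in\mathcal{S}_{\rm KKT}(0,0)$. Define the sets $$\Sigma(\overline{x},\overline{\lambda}):=\Big\{(\xi,\zeta)\in\mathbb{X}\times\mathbb{Y}:\ \nabla_{xx}^2L(\overline{x},\overline{\lambda})\xi+\nabla g(\overline{x})\big[\zeta+\tfrac12\nabla\Upsilon(g'(\overline{x})\xi)\big]=0\Big\},$$ $$\Gamma(\overline{x},\overline{\lambda}):=\Big\{(\xi,\zeta)\in\mathbb{X}\times\mathbb{Y}:\ g'(\overline{x})\xi\in\mathcal{C}_{\mathcal{K}}(g(\overline{x}),\overline{\lambda}),\ \zeta\in[\mathcal{C}_{\mathcal{K}}(g(\overline{x}),\overline{\lambda})]^{\circ}\Big\}.$$ Suppose that $\langle g'(\overline{x})\xi,\zeta\rangle\ge0$ for any $(\xi,\zeta)\in\Sigma(\overline{x},\overline{\lambda})\cap\Gamma(\overline{x},\overline{\lambda})$ and that $\nabla g(\overline{x})[\mathcal{C}_{\mathcal{K}}(g(\overline{x}),\overline{\lambda})]^{\circ}$ is closed. If the Lagrange multiplier $\overline{\lambda}$ is noncritical for the unperturbed problem, then $\mathcal{X}_{\rm KKT}$ has the pseudo-isolated calmness at the origin for $\overline{x}$ (with respect to $\overline{\lambda}$).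
   Context: Setting. $\mathbb{X},\mathbb{Y}$ are finite dimensional real vector spaces with inner product $\langle\cdot,\cdot\rangle$ and induced norm $\|\cdot\|$; $f:\mathbb{X}\to\mathbb{R}$ and $g:\mathbb{X}\to\mathbb{Y}$ are twice continuously differentiable; $\mathcal{K}\subseteq\mathbb{Y}$ is a nonempty closed convex set which is $C^2$-cone reducible: at every $\overline{y}\in\mathcal{K}$ there exist an open neighborhood $\mathcal{Y}$ of $\overline{y}$, a pointed closed convex cone $D$ in a finite dimensional space $\mathbb{Z}$, and a twice continuously differentiable $\Xi:\mathcal{Y}\to\mathbb{Z}$ with $\Xi(\overline{y})=0$, $\Xi'(\overline{y}):\mathbb{Y}\to\mathbb{Z}$ onto, and $\mathcal{K}\cap\mathcal{Y}=\{y\in\mathcal{Y}\mid\Xi(y)\in D\}$. The perturbed problem with parameter $(a,b)\in\mathbb{X}\times\mathbb{Y}$ is $\min_{x\in\mathbb{X}}\{f(x)-\langle a,x\rangle : g(x)-b\in\mathcal{K}\}$; the unperturbed problem has $(a,b)=(0,0)$. Notation. $h'(x)$ is the derivative of $h$ at $x$, $\nabla h(x)$ its adjoint, $h''(x)$ the second derivative. $L(x,\lambda):=f(x)+\langle\lambda,g(x)\rangle$, so $\nabla_xL(x,\lambda)=\nabla f(x)+\nabla g(x)\lambda$; $\nabla^2_{xx}L$ is its Hessian in $x$. $\mathcal{N}_{\mathcal{K}}$ and $\mathcal{T}_{\mathcal{K}}$ are the normal cone and the contingent (tangent) cone of $\mathcal{K}$; $K^{\circ}$ is the negative polar of a convex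 cone $K$; $\mathbb{B}_{\delta}(z)$ is the closed ball of radius $\delta$ centered at $z$. The critical cone of $\mathcal{K}$ at $y\in\mathcal{K}$ with respect to $u\in\mathcal{N}_{\mathcal{K}}(y)$ is $\mathcal{C}_{\mathcal{K}}(y,u):=\mathcal{T}_{\mathcal{K}}(y)\cap u^{\perp}$. The function $\Upsilon$. Let $\overline{y}:=g(\overline{x})$, and let $\Xi,D$ be a reduction of $\mathcal{K}$ at $\overline{y}$, that is, $D$ is a pointed closed convex cone in a finite dimensional space $\mathbb{Z}$ and $\Xi:\mathcal{Y}\to\mathbb{Z}$ is a twice continuously differentiable mapping on an open neighborhood $\mathcal{Y}$ of $\overline{y}$ with $\Xi(\overline{y})=0$, $\Xi'(\overline{y}):\mathbb{Y}\to\mathbb{Z}$ onto, and $\mathcal{K}\cap\mathcal{Y}=\{y\in\mathcal{Y}\mid\Xi(y)\in D\}$; and let $\overline{\mu}\in\mathcal{N}_D(\Xi(\overline{y}))$ be the unique vector with $\overline{\lambda}=\nabla\Xi(\overline{y})\overline{\mu}$. Then $\Upsilon(h):=\langle\overline{\mu},\Xi''(\overline{y})(h,h)\rangle$; for $h\in\mathcal{C}_{\mathcal{K}}(\overline{y},\overline{\lambda})$ this equals $-\sigma(\overline{\lambda},\mathcal{T}^2_{\mathcal{K}}(\overline{y},h))$, where $\sigma(\overline{\lambda},\cdot)$ denotes the support function value at $\overline{\lambda}$ and $\mathcal{T}^2_{\mathcal{K}}(\overline{y},h)$ is the (outer) second order tangent set. KKT mappings. $\mathcal{S}_{\rm KKT}(a,b):=\{(x,\lambda)\in\mathbb{X}\times\mathbb{Y}\mid\nabla_xL(x,\lambda)=a,\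 \lambda\in\mathcal{N}_{\mathcal{K}}(g(x)-b)\}$; $\mathcal{X}_{\rm KKT}(a,b):=\{x\in\mathbb{X}\mid\exists\lambda\in\mathbb{Y},\ (x,\lambda)\in\mathcal{S}_{\rm KKT}(a,b)\}$; $\mathcal{M}(x,a,b):=\{\lambda\in\mathbb{Y}\mid(x,\lambda)\in\mathcal{S}_{\rm KKT}(a,b)\}$. Noncriticality. For a multifunction $\mathcal{F}$, the graphical derivative is defined by $\Delta w\in D\mathcal{F}(\overline{z}|\overline{w})(\Delta z)$ iff $(\Delta z,\Delta w)$ belongs to the contingent cone of ${\rm gph}\,\mathcal{F}$ at $(\overline{z},\overline{w})$. The multiplier $\overline{\lambda}\in\mathcal{M}(\overline{x},0,0)$ is noncritical if $\xi=0$ is the only solution of $0\in\nabla^2_{xx}L(\overline{x},\overline{\lambda})\xi+\nabla g(\overline{x})D\mathcal{N}_{\mathcal{K}}(g(\overline{x})|\overline{\lambda})(g'(\overline{x})\xi)$. Pseudo-isolated calmness. For $\overline{\lambda}\in\mathcal{M}(\overline{x},0,0)$, $\mathcal{X}_{\rm KKT}$ has the pseudo-isolated calmness at the origin for $\overline{x}$ (the multiplier $\overline{\lambda}$ being fixed) if there exist $\varepsilon,\delta,\kappa>0$ such that for any $(a,b)$ with $\|(a,b)\|\le\delta$ and any $(x,\lambda)\in\mathcal{S}_{\rm KKT}(a,b)\cap\mathbb{B}_{\varepsilon}((\overline{x},\overline{\lambda}))$, $\|x-\overline{x}\|\le\kappa\|(a,b)\|$. *)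

(* Defs.v *)
From HB Require Import structures.
From mathcomp Require Import all_boot all_order all_algebra.
From mathcomp Require Import sesquilinear.
From mathcomp Require Import all_classical all_reals all_analysis.

Set Implicit Arguments.
Unset Strict Implicit.
Unset Printing Implicit Defensive.

Import Order.TTheory GRing.Theory Num.Theory.
Import numFieldNormedType.Exports.

Local Open Scope classical_set_scope.
Local Open Scope ring_scope.

(* Finite dimensional real inner product spaces: Vector provides the finite
   dimension, and the norm of NormedModule is the one induced by dot. *)
HB.mixin Record NormedVector_isEuclidean (R : realType) V
    & NormedModule R V & Vector R V := {
  dot : {dot V for idfun} ;
  dot_norm : forall x : V, dot x x = `|x| ^+ 2
}.

#[short(type="euclideanType")]
HB.structure Definition Euclidean (R : realType) :=
  { V of NormedModule R V & Vector R V & NormedVector_isEuclidean R V }.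

(* The norm on V * W induced by <(x, y), (x', y')> = <x, x'> + <y, y'>; the
   library's norm on V * W is the maximum of the two norms. *)
Definition pair_norm (R : realType) (V W : euclideanType R) (x : V) (y : W) : R :=
  Num.sqrt (`|x| ^+ 2 + `|y| ^+ 2).

Section Derivatives.
Context {R : realType}.

(* h''(x)(v, w) *)
Definition diff2 (V W : normedModType R) (h : V -> W) (x v w : V) : W :=
  'd (fun y => 'd h y v) x w.

(* V is meant to be finite dimensional and U to be open: then all norms on the
   spaces of linear and bilinear maps define the topology of pointwise
   convergence, so that the existence and the continuity of h'' can be stated
   for each value of its arguments. Continuity of h and h' on U follows from
   differentiability. *)
Definition C2_on (V W : normedModType R) (U : set V) (h : V -> W) : Prop :=
  forall x, U x ->
    [/\ differentiable h x,
        forall v, differentiable (fun y => 'd h y v) x &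
        forall v w, {for x, continuous (fun y => diff2 h y v w)}].

(* get picks the element of a singleton; see adjointP and gradientP below. *)
Definition adjoint (V W : euclideanType R) (A : V -> W) (y : W) : V :=
  get [set u : V | forall v, dot u v = dot y (A v)].

Definition gradient (V : euclideanType R) (phi : V -> R) (x : V) : V :=
  get [set u : V | forall v, dot u v = 'd phi x v].

Definition hessian (V : euclideanType R) (phi : V -> R) (x : V) : V -> V :=
  'd (gradient phi) x.

Lemma dot_eq0 (V : euclideanType R) (u : V) : dot u u = 0 -> u = 0.
Proof.
by move=> /eqP; rewrite dot_norm expf_eq0/= normr_eq0 => /eqP.
Qed.

Lemma dotC (V : euclideanType R) (u v : V) : dot u v = dot v u.
Proof. by rewrite hermC expr0 mul1r. Qed.

Lemma riesz (V : euclideanType R) (l : {scalar V}) :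
  exists u : V, forall v, dot u v = l v.
Proof.
pose e := vbasis {:V}.
have ebasis : basis_of {:V} e by exact: vbasisP.
have efree : free e by case/andP: ebasis.
pose T (u : V) : V := \sum_(i < \dim {:V}) dot u e`_i *: e`_i.
have Tlin : linear T.
  move=> a u v; rewrite /T scaler_sumr -big_split/=; apply: eq_bigr => i _.
  by rewrite linearPl/= scalerDl scalerA.
pose TL := GRing.isLinear.Build _ _ _ _ T Tlin.
pose T' : {linear V -> V} := HB.pack T TL.
have dotP (u v : V) : dot u v = \sum_(i < \dim {:V}) coord e i v * dot u e`_i.
  rewrite {1}(coord_basis ebasis (memvf v)) linear_sum/=.
  by apply: eq_bigr => i _; rewrite linearZ.
have ker0 : lker (linfun T') == 0%VS.
  apply/lker0P => u v; rewrite !lfunE/= => Tuv.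
  suff /dot_eq0/subr0_eq : dot (u - v) (u - v) = 0 by [].
  have /freeP h := efree; rewrite dotP big1// => i _.
  rewrite (h (fun i => dot (u - v) e`_i)) ?mulr0//.
  transitivity (T u - T v); last by rewrite [T u]Tuv subrr.
  rewrite /T -sumrB; apply: eq_bigr => j _.
  by rewrite linearBl/= scalerBl.
pose b : V := \sum_(i < \dim {:V}) l e`_i *: e`_i.
exists ((linfun T')^-1%VF b).
set u := (_ b); have Tu : T u = b.
  by have := lker0_lfunVK ker0 b; rewrite lfunE.
have ue (i : 'I_(\dim {:V})) : dot u e`_i = l e`_i.
  apply: subr0_eq; have /freeP h := efree.
  have sum0 : \sum_(j < \dim {:V}) (dot u e`_j - l e`_j) *: e`_j = 0.
    transitivity (T u - b); last by rewrite Tu subrr.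
    rewrite /T /b -sumrB; apply: eq_bigr => j _.
    by rewrite scalerBl.
  exact: (h (fun j => dot u e`_j - l e`_j) sum0 i).
move=> v; rewrite dotP {2}(coord_basis ebasis (memvf v)) linear_sum/=.
by apply: eq_bigr => i _; rewrite linearZ/= ue.
Qed.

Lemma dot_inj (V : euclideanType R) (u u' : V) :
  (forall v, dot u v = dot u' v) -> u = u'.
Proof.
move=> uu'; apply/subr0_eq/dot_eq0.
by rewrite linearBl/= uu' subrr.
Qed.

Lemma adjointP (V W : euclideanType R) (A : {linear V -> W}) (y : W) (v : V) :
  dot (adjoint A y) v = dot y (A v).
Proof.
suff : [set u : V | forall v, dot u v = dot y (A v)] !=set0.
  by move=> /(@getPex V); exact.
have lin : scalar (fun v => dot y (A v)) by move=> a u w; rewrite !linearP.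
pose L := GRing.isLinear.Build _ _ _ _ (fun v => dot y (A v)) lin.
by have [u uP] := riesz (HB.pack (fun v => dot y (A v)) L); exists u.
Qed.

Lemma gradientP (V : euclideanType R) (phi : V -> R) (x v : V) :
  dot (gradient phi x) v = 'd phi x v.
Proof.
suff : [set u : V | forall v, dot u v = 'd phi x v] !=set0.
  by move=> /(@getPex V); exact.
by have [u uP] := riesz ('d phi x); exists u.
Qed.

End Derivatives.

Section Cones.
Context {R : realType}.

Definition contingent_cone (V : normedModType R) (A : set V) (z : V) : set V :=
  [set w | exists (t : nat -> R) (w_ : nat -> V),
     [/\ forall k, 0 < t k, t @ \oo --> (0 : R), w_ @ \oo --> w
       & forall k, A (z + t k *: w_ k)]].

(* The normal cone of convex analysis, empty at points outside of A. *)
Definition normal_cone (V : euclideanType R) (A : set V) (y : V) : set V :=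
  [set u | A y /\ forall z, A z -> dot u (z - y) <= 0].

Definition polar (V : euclideanType R) (C : set V) : set V :=
  [set u | forall w, C w -> dot u w <= 0].

Definition critical_cone (V : euclideanType R) (A : set V) (y u : V) : set V :=
  contingent_cone A y `&` [set w | dot u w = 0].

Definition graphical_derivative (V W : normedModType R) (F : V -> set W)
    (z : V) (w : W) (dz : V) : set W :=
  [set dw | contingent_cone [set p : V * W | F p.1 p.2] (z, w) (dz, dw)].

Record pointed_closed_convex_cone (V : euclideanType R) (D : set V) : Prop := {
  cone_closed : closed D ;
  cone_convex : convex_set D ;
  cone0 : D 0 ;
  cone_scale : forall (t : R) z, 0 < t -> D z -> D (t *: z) ;
  cone_pointed : forall z, D z -> D (- z) -> z = 0
}.

(* Only the values of Xi on U matter. *)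
Record C2_reduction (V Z : euclideanType R) (K : set V) (ybar : V)
    (U : set V) (Xi : V -> Z) (D : set Z) : Prop := {
  red_open : open U ;
  red_nbhs : U ybar ;
  red_cone : pointed_closed_convex_cone D ;
  red_C2 : C2_on U Xi ;
  red0 : Xi ybar = 0 ;
  red_onto : range ('d Xi ybar) = [set: Z] ;
  red_eq : K `&` U = U `&` Xi @^-1` D
}.

Definition C2_cone_reducible (V : euclideanType R) (K : set V) : Prop :=
  forall y, K y -> exists (Z : euclideanType R) (U : set V) (Xi : V -> Z)
    (D : set Z), C2_reduction K y U Xi D.

Definition Upsilon (V Z : euclideanType R) (Xi : V -> Z) (ybar : V) (mu : Z)
    (h : V) : R :=
  dot mu (diff2 Xi ybar h h).

End Cones.

Section KKT.
Context {R : realType} {X Y : euclideanType R}.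
Variables (f : X -> R) (g : X -> Y) (K : set Y).

Definition lagrangian (lambda : Y) (x : X) : R := f x + dot lambda (g x).

Definition S_KKT (a : X) (b : Y) : set (X * Y) :=
  [set z | gradient (lagrangian z.2) z.1 = a /\ normal_cone K (g z.1 - b) z.2].

Definition noncritical (x : X) (lambda : Y) : Prop :=
  [set xi | exists2 eta : Y,
     graphical_derivative (normal_cone K) (g x) lambda ('d g x xi) eta
     & hessian (lagrangian lambda) x xi + adjoint ('d g x) eta = 0] = [set 0].

(* The pseudo-isolated calmness of X_KKT at the origin for x, the multiplier
   lambda being fixed. *)
Definition pseudo_isolated_calm (xbar : X) (lbar : Y) : Prop :=
  exists eps delta kappa : R, [/\ 0 < eps, 0 < delta, 0 < kappa &
    forall a b, pair_norm a b <= delta ->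
    forall x lambda, S_KKT a b (x, lambda) ->
      pair_norm (x - xbar) (lambda - lbar) <= eps ->
      `|x - xbar| <= kappa * pair_norm a b].

Definition Sigma_set (Ups : Y -> R) (x : X) (lambda : Y) : set (X * Y) :=
  [set p | hessian (lagrangian lambda) x p.1 +
           adjoint ('d g x) (p.2 + 2^-1 *: gradient Ups ('d g x p.1)) = 0].

Definition Gamma_set (x : X) (lambda : Y) : set (X * Y) :=
  [set p | critical_cone K (g x) lambda ('d g x p.1) /\
           polar (critical_cone K (g x) lambda) p.2].

End KKT.

(* Main.v *)
(** Suppose calmness fails along KKT points [(x_k, lambda_k)] with perturbations
    [(a_k, b_k) = o(t_k)], [t_k = |x_k - xbar|], and let [xi] be a limit of
    [(x_k - xbar) / t_k]; put [h = g'(xbar) xi].  Writing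
    [lambda_k = Xi'(y_k)^* mu_k] with [y_k = g(x_k) - b_k], the quotient
    [(lambda_k - lbar) / t_k] splits into [nu_k] in the polar of the critical cone
    plus a term converging to half the gradient of [Upsilon] at [h].  The [nu_k] may
    be unbounded, but their images under [g'(xbar)^*] converge, and closedness
    provides [zeta] in the polar cone with the same limit image, so that [(xi, zeta)]
    lies in Sigma and Gamma.  Hence [<h, zeta> = 0], which puts
    [zeta + grad Upsilon(h) / 2] in the graphical derivative of the normal cone
    mapping at [h]; noncriticality gives [xi = 0], against [|xi| = 1].

    That last membership is obtained by projecting onto [K] the points
    [ybar + s lbar + t (h + s (zeta + grad Upsilon(h) / 2))], [t -> 0]: for [s]
    small enough the curvature of [K] is dominated by the identity, and the same
    splitting of multipliers identifies the limit of the difference quotients of the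
    projections as [h]. *)

Require Import Defs.
From mathcomp Require Import all_boot all_order all_algebra.
From mathcomp Require Import all_classical all_reals all_analysis.
From mathcomp Require Import ring lra.

Import Order.TTheory GRing.Theory Num.Theory.
Import numFieldNormedType.Exports.

Local Open Scope classical_set_scope.
Local Open Scope ring_scope.

(** * Inner products and finite dimension *)

Section Dot.
Context {R : realType} {V : euclideanType R}.
Implicit Types u v w : V.

Lemma dotDl u v w : dot (u + v) w = dot u w + dot v w.
Proof. exact: linearDl. Qed.
Lemma dotBl u v w : dot (u - v) w = dot u w - dot v w.
Proof. exact: linearBl. Qed.
Lemma dotZl a u w : dot (a *: u) w = a * dot u w.
Proof. exact: linearZl_LR. Qed.
Lemma dotDr u v w : dot w (u + v) = dot w u + dot w v.
Proof. by rewrite !(dotC w) dotDl. Qed.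
Lemma dotBr u v w : dot w (u - v) = dot w u - dot w v.
Proof. by rewrite !(dotC w) dotBl. Qed.
Lemma dotZr a u w : dot w (a *: u) = a * dot w u.
Proof. by rewrite !(dotC w) dotZl. Qed.
Lemma dot0r u : dot u 0 = 0.
Proof. by rewrite -(scale0r 0) dotZr mul0r. Qed.
Lemma dot0l u : dot 0 u = 0.
Proof. by rewrite dotC dot0r. Qed.
Lemma dotNr u v : dot u (- v) = - dot u v.
Proof. by rewrite -scaleN1r dotZr mulN1r. Qed.

(** Cauchy-Schwarz: the squared norm of [|v|^2 u - <u, v> v] is [|v|^2] times the gap between the
    squares of the two sides. *)
Lemma normr_dot u v : `|dot u v| <= `|u| * `|v|.
Proof.
have [->|v0] := eqVneq v 0; first by rewrite dot0r !normr0 mulr0.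
have nv : 0 < `|v| ^+ 2 by rewrite exprn_gt0// normr_gt0.
have : 0 <= `| (`|v| ^+ 2) *: u - dot u v *: v | ^+ 2 by rewrite sqr_ge0.
rewrite -dot_norm !(dotBl, dotBr, dotZl, dotZr) (dotC v u) !dot_norm => h.
have {}h : 0 <= `|v| ^+ 2 * ((`|u| * `|v|) ^+ 2 - dot u v ^+ 2).
  by apply: le_trans h _; rewrite le_eqVlt; apply/orP; left; apply/eqP; ring.
move: h; rewrite pmulr_rge0// subr_ge0 => h.
by rewrite -ler_sqr ?nnegrE ?mulr_ge0// real_normK// num_real.
Qed.

Lemma continuous_dotl v : continuous (fun u : V => dot u v).
Proof.
move=> x; apply/cvgrPdist_le => e e0; near=> y.
rewrite -dotBl (le_trans (normr_dot _ _))//.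
have h : `|x - y| <= e / (`|v| + 1).
  near: y; have /cvgrPdist_le : id @ x --> x by exact: cvg_id.
  by apply; rewrite divr_gt0// ltr_wpDl.
rewrite (le_trans (ler_wpM2r _ h))// mulrAC ler_pdivrMr ?ltr_wpDl//.
by rewrite ler_pM2l// lerDl.
Unshelve. all: by end_near. Qed.

Lemma continuous_dotr u : continuous (fun v : V => dot u v).
Proof.
by under eq_fun do rewrite dotC; exact: continuous_dotl.
Qed.

Lemma cvg_dot T (F : set_system T) {FF : Filter F} (a b : T -> V) u v :
  a @ F --> u -> b @ F --> v -> (fun x => dot (a x) (b x)) @ F --> dot u v.
Proof.
move=> au bv.
have h : (fun x => dot (a x - u) (b x - v)) @ F --> (0 : R).
  apply/norm_cvg0P.
  have z : (fun x => `|a x - u| * `|b x - v|) @ F --> (0 : R).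
    rewrite -(mulr0 (0 : R)); apply: cvgM.
      by apply/norm_cvg0P; rewrite -(subrr u); apply: cvgB => //; exact: cvg_cst.
    by apply/norm_cvg0P; rewrite -(subrr v); apply: cvgB => //; exact: cvg_cst.
  apply: squeeze_cvgr (cvg_cst _) z; near=> x.
  by rewrite normr_ge0 normr_dot.
(* Apart from the product of the two increments, which tends to 0, the remaining terms depend on [a]
   and [b] separately. *)
have -> : (fun x => dot (a x) (b x)) =
    (fun x => dot (a x - u) (b x - v) + dot u (b x) + dot (a x) v - dot u v).
  by apply/funext => x; rewrite !(dotBl, dotBr); ring.
rewrite [X in _ --> X](_ : _ = 0 + dot u v + dot u v - dot u v); last by ring.
apply: cvgB; last exact: cvg_cst.
apply: cvgD; last exact: (cvg_comp _ _ au (@continuous_dotl v u)).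
by apply: cvgD => //; exact: (cvg_comp _ _ bv (@continuous_dotr u v)).
Unshelve. all: by end_near. Qed.

(** Coordinates become inner products, hence are bounded by Cauchy-Schwarz. The default 0 is never
    taken, by [riesz]. *)
Definition dual_basis i : V := xget 0 [set u | forall v, dot u v = coord (vbasis {:V}) i v].

Lemma dual_basisP i v : dot (dual_basis i) v = coord (vbasis {:V}) i v.
Proof.
rewrite /dual_basis; case: xgetP => [u _ ->//|h].
by have [u uP] := riesz (coord (vbasis {:V}) i); case: (h u).
Qed.

Lemma dot_expansion v : v = \sum_(i < \dim {:V}) dot (dual_basis i) v *: (vbasis {:V})`_i.
Proof.
rewrite {1}(coord_vbasis (memvf v)); apply: eq_bigr => i _.
by rewrite dual_basisP.
Qed.

Lemma dual_expansion v : v = \sum_(i < \dim {:V}) dot v (vbasis {:V})`_i *: dual_basis i.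
Proof.
apply: dot_inj => w; rewrite linear_sumlz/= {1}(dot_expansion w).
rewrite linear_sum/=; apply: eq_bigr => i _.
by rewrite dotZl dotZr mulrC.
Qed.

(** In finite dimension weak convergence suffices: [dual_expansion] is a finite sum whose
    coefficients are inner products. *)
Lemma cvg_dotP T (F : set_system T) {FF : Filter F} (a : T -> V) u :
  (forall w, (fun x => dot (a x) w) @ F --> dot u w) -> a @ F --> u.
Proof.
move=> h; rewrite (dual_expansion u).
rewrite (_ : a = fun x => \sum_(i < \dim {:V}) dot (a x) (vbasis {:V})`_i *: dual_basis i).
  2: by apply/funext => x; exact: dual_expansion.
apply: cvg_big => [|i _]; first exact: add_continuous.
by apply: cvgZr_tmp; exact: h.
Qed.

End Dot.

Section FiniteDim.
Context {R : realType} {V : euclideanType R}.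

Lemma linear_bounded (W : normedModType R) (A : {linear V -> W}) :
  exists2 M, 0 < M & forall v, `|A v| <= M * `|v|.
Proof.
exists (1 + \sum_(i < \dim {:V}) `|dual_basis i : V| * `|A (vbasis {:V})`_i|).
  by rewrite ltr_pwDl// sumr_ge0// => i _; rewrite mulr_ge0.
move=> v; rewrite mulrDl mul1r -[leLHS]add0r lerD// {1}(dot_expansion v) linear_sum.
rewrite mulr_suml (le_trans (ler_norm_sum _ _ _))// ler_sum// => i _.
by rewrite linearZ/= normrZ mulrAC ler_wpM2r// normr_dot.
Qed.

Lemma linear_continuous_fd (W : normedModType R) (A : {linear V -> W}) :
  continuous A.
Proof.
have [M M0 AM] := linear_bounded W A.
by apply/linear_bounded_continuous/linear_boundedP; near=> r => v; rewrite (le_trans (AM v))// ler_wpM2r//.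
Unshelve. all: by end_near. Qed.

(** The ball is a closed subset of the image of a cube of coordinates under a continuous map; [N] is
    one bound for all coordinates. *)
Lemma closed_ball_compact (x : V) r : compact [set y | `|y - x| <= r].
Proof.
pose n := \dim {:V}.
pose T (c : 'rV[R]_n) : V := x + \sum_(i < n) c ord0 i *: (vbasis {:V})`_i.
have Tc : continuous T.
  move=> c; rewrite /continuous_at /T; apply: (@cvgD _ _ _ (nbhs c)); first exact: cvg_cst.
  apply: cvg_big => [|i _]; first exact: add_continuous.
  by apply: cvgZr_tmp; exact: coord_continuous.
pose N := \sum_(i < n) `|dual_basis i : V| * r.
pose S := [set c : 'rV[R]_n | forall i, `[- N, N]%classic (c ord0 i)].
have Sc : compact S.
  by apply: (@rV_compact _ n (fun=> `[- N, N]%classic)) => i; exact: segment_compact.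
have TSc : compact (T @` S).
  by apply: continuous_compact => //; exact: continuous_subspaceT.
apply: (subclosed_compact _ TSc).
  rewrite -/((fun y => `|y - x|) @^-1` [set s | s <= r]).
  apply: preimage_closed => [y _|]; last exact: closed_le.
  by apply: cvg_norm; apply: cvgB; [exact: cvg_id|exact: cvg_cst].
move=> y /= yr; exists (\row_i dot (dual_basis i) (y - x)) => /=; last first.
  rewrite /T; under eq_bigr do rewrite mxE.
  by rewrite -dot_expansion addrC subrK.
move=> i; rewrite mxE/= in_itv/= -ler_norml (le_trans (normr_dot _ _))//.
have r0 : 0 <= r by rewrite (le_trans _ yr).
rewrite /N (bigD1 i)//= (le_trans (ler_wpM2l _ yr))// lerDl sumr_ge0// => j _.
by rewrite mulr_ge0.
Qed.

(** Bolzano-Weierstrass. Since [s] need not be increasing, it is enough to pick for each [k] an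
    index beyond [k] at distance at most [1 / (k + 1)] from a cluster point. *)
Lemma bounded_subseq (u : nat -> V) M : (forall k, `|u k| <= M) ->
  exists (s : nat -> nat) (l : V), s @ \oo --> \oo /\ u \o s @ \oo --> l.
Proof.
move=> uM.
have [|l [_ lcl]] := closed_ball_compact 0 M (u @ \oo) _.
  by exists 0%N => // k _ /=; rewrite subr0.
have P k : exists p, (k <= p)%N /\ `|l - u p| <= k.+1%:R^-1.
  have [||z [/= [p [kp <-]] zl]] := lcl (u @` [set p | (k <= p)%N]) [set y | `|l - y| <= k.+1%:R^-1].
  - by exists k => // p kp /=; exists p.
  - have /cvgrPdist_le : id @ l --> l by exact: cvg_id.
    by apply; rewrite invr_gt0.
  by exists p.
have [s sP] := choice P; exists s, l; split.
  move=> A [N _ NA]; exists N => // k /= Nk; apply: NA => /=.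
  by rewrite (leq_trans Nk)//; case: (sP k).
apply/cvgrPdist_le => e e0; near=> k.
rewrite (le_trans (sP k).2)//.
apply/ltW; near: k; exact: (near_infty_natSinv_lt (PosNum e0)).
Unshelve. all: by end_near. Qed.

End FiniteDim.

(** * Derivatives *)

Section Diff.
Context {R : realType}.

Lemma differentiable_bound (V W : normedModType R) (h : V -> W) x :
  differentiable h x -> forall e, 0 < e ->
  exists2 d, 0 < d &
    forall v, `|v| < d -> `|h (x + v) - h x - 'd h x v| <= e * `|v|.
Proof.
move=> /diff_locallyP[_ /eqaddoP hx] e e0.
have /nbhs_norm0P[d d0 dP] := hx e e0.
exists d => // v vd; have := dP v vd.
rewrite [X in `|X|](_ : _ = h (v + x) - (h x + 'd h x v))//.
by rewrite opprD addrA (addrC v).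
Qed.

Lemma diff_eq_bound (V : euclideanType R) (W : normedModType R) (h : V -> W)
    (df : {linear V -> W}) x :
  (forall e, 0 < e -> exists2 d, 0 < d &
    forall v, `|v| < d -> `|h (x + v) - h x - df v| <= e * `|v|) ->
  'd h x = df :> (V -> W).
Proof.
move=> H; apply: diff_unique; first exact: linear_continuous_fd.
apply/eqaddoP => e e0; have [d d0 dP] := H e e0.
apply/nbhs_norm0P; exists d => // v /= vd; have := dP v vd.
rewrite [X in _ -> `|X| <= _](_ : _ = h (v + x) - (h x + df v))//.
by rewrite opprD addrA (addrC v).
Qed.

(** The directions [w k] may vary: they are eventually bounded by [M], so the remainder of the
    expansion, divided by [t k], is at most [e]. *)
Lemma cvg_difference_quotient (V W : normedModType R) (h : V -> W) x T
    (F : set_system T) {FF : Filter F} (t : T -> R) (w : T -> V) xi :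
  differentiable h x -> (\forall k \near F, t k != 0) -> t @ F --> (0 : R) ->
  w @ F --> xi ->
  (fun k => (t k)^-1 *: (h (x + t k *: w k) - h x)) @ F --> 'd h x xi.
Proof.
move=> dh tn0 t0 wxi.
have dw : (fun k => 'd h x (w k)) @ F --> 'd h x xi.
  by apply: (cvg_comp _ _ wxi); exact: (diff_continuous dh).
rewrite -[X in _ --> X]add0r.
rewrite (_ : (fun k => _) = (fun k => ((t k)^-1 *: (h (x + t k *: w k) - h x) - 'd h x (w k)) + 'd h x (w k))); last first.
  by apply/funext => k; rewrite subrK.
apply: cvgD => //; apply/cvgr0Pnorm_le => e e0.
pose M := `|xi| + 1; have M0 : 0 < M by rewrite ltr_wpDl.
have [d d0 dP] := differentiable_bound _ _ _ _ dh (e / M) (divr_gt0 e0 M0).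
near=> k.
have wM : `|w k| <= M.
  near: k; apply: (@cvgr_norm_le _ _ _ _ _ _ xi wxi); by rewrite ltrDl.
have tk0 : t k != 0 by near: k.
have twd : `|t k *: w k| < d.
  rewrite normrZ (le_lt_trans (ler_wpM2l _ wM))// -ltr_pdivlMr//.
  near: k; apply: (@cvgr0_norm_lt _ _ _ _ _ _ t0); exact: divr_gt0.
have -> : (t k)^-1 *: (h (x + t k *: w k) - h x) - 'd h x (w k) =
   (t k)^-1 *: (h (x + t k *: w k) - h x - 'd h x (t k *: w k)).
  by rewrite linearZ/= [in RHS]scalerBr scalerA mulVf// scale1r.
rewrite normrZ normfV ler_pdivrMl ?normr_gt0// (le_trans (dP _ twd))//.
rewrite normrZ mulrCA ler_wpM2l// mulrAC ler_pdivrMr//.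
by rewrite ler_wpM2l// ltW.
Unshelve. all: by end_near. Qed.

Lemma is_derive_line (V W : normedModType R) (h : V -> W) (a v : V) s :
  differentiable h (a + s *: v) ->
  is_derive s 1 (fun s => h (a + s *: v)) ('d h (a + s *: v) v).
Proof.
move=> dh.
have E : (fun k : R => k^-1 *: (((fun s => h (a + s *: v)) \o shift s) (k *: 1) -
    h (a + s *: v))) =
  (fun k => k^-1 *: ((h \o shift (a + s *: v)) (k *: v) - h (a + s *: v))).
  apply/funext => k /=; congr (_ *: (h _ - _)).
  by rewrite [k *: 1]mulr1 scalerDl addrCA.
split; first by rewrite /derivable E; exact: diff_derivable.
by rewrite /derive E; exact: deriveE.
Qed.

(* The second difference is symmetric in [v] and [w], and by the mean value theorem
   it is [t ^+ 2 * 'd a x w] up to [o(t ^+ 2)], where [a] is the derivative of [phi]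
   along [v]. *)
Lemma schwarz_bound (V : normedModType R) (phi a : V -> R) x v w :
  (\forall y \near x, differentiable phi y /\ 'd phi y v = a y) ->
  differentiable a x ->
  forall e, 0 < e -> exists2 d, 0 < d & forall t, 0 < t < d ->
  `|phi (x + t *: v + t *: w) - phi (x + t *: v) - phi (x + t *: w) + phi x
    - t ^+ 2 * 'd a x w| <= e * t ^+ 2.
Proof.
move=> dphi dphi' e e0.
(* For [0 <= s <= t], the sum of the norms of [s *: v] and [t *: w + s *: v] is at most [t * M]. *)
pose M := `|v| + (`|v| + `|w|) + 1.
have vw0 : 0 <= `|v| + `|w| by rewrite addr_ge0.
have M0 : 0 < M by rewrite ltr_wpDl// addr_ge0.
have [d1 d10 dP1] := differentiable_bound _ _ _ _ dphi' (e / M) (divr_gt0 e0 M0).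
move: dphi => /nbhs_normP[d2 /= d20 dP2].
exists (Num.min d1 d2 / M); first by rewrite divr_gt0// lt_min d10.
move=> t /andP[t0 td].
have vM : `|v| <= M by rewrite /M; have := normr_ge0 w; lra.
have vwM : `|v| + `|w| <= M by rewrite /M; have := normr_ge0 v; lra.
have tMd : t * M < Num.min d1 d2 by rewrite -ltr_pdivlMr.
have sv s : 0 <= s <= t -> `|s *: v| <= t * `|v|.
  by move=> /andP[s0 st]; rewrite normrZ ger0_norm// ler_wpM2r.
have svw s : 0 <= s <= t -> `|t *: w + s *: v| <= t * (`|v| + `|w|).
  move=> st; rewrite mulrDr addrC (le_trans (ler_normD _ _))// lerD ?sv//.
  by rewrite normrZ gtr0_norm.
have small z : `|z| <= t * M ->
    [/\ `|z| < d1, differentiable phi (x + z) & 'd phi (x + z) v = a (x + z)].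
  move=> /le_lt_trans/(_ tMd); rewrite lt_min => /andP[zd1 zd2].
  have [|dz az] := dP2 (x + z); last by split.
  by rewrite /= opprD addrA subrr sub0r normrN.
have D1 s : 0 <= s <= t ->
    [/\ `|s *: v| < d1, differentiable phi (x + s *: v) & 'd phi (x + s *: v) v = a (x + s *: v)].
  by move=> st; apply: small; rewrite (le_trans (sv _ st))// ler_wpM2l// ltW.
have D2 s : 0 <= s <= t -> [/\ `|t *: w + s *: v| < d1,
    differentiable phi (x + t *: w + s *: v) & 'd phi (x + t *: w + s *: v) v = a (x + t *: w + s *: v)].
  move=> st; rewrite -addrA; apply: small.
  by rewrite (le_trans (svw _ st))// ler_wpM2l// ltW.
(* The second difference is [th t - th 0], equal to [t * th' s] for some intermediate [s]; both
   terms of [th' s] are then expanded at [x]. *)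
pose th s := phi (x + t *: w + s *: v) - phi (x + s *: v).
pose th' s := a (x + t *: w + s *: v) - a (x + s *: v).
have thD s : 0 <= s <= t -> is_derive s 1 th (th' s).
  move=> st; have [_ d2s a2s] := D2 s st; have [_ d1s a1s] := D1 s st.
  by rewrite /th' -a1s -a2s; apply: is_deriveB; apply: is_derive_line.
have [s||s st thE] := @MVT R th th' 0 t t0.
- by rewrite in_itv/= => /andP[/ltW s0 /ltW st]; apply: thD; rewrite s0.
- apply: derivable_within_continuous => s; rewrite in_itv/= => st.
  by case: (thD s st).
have {}st : 0 <= s <= t by move: st; rewrite in_itv/= => /andP[/ltW -> /ltW ->].
have [/(dP1 _) b1 _ _] := D1 s st; have [/(dP1 _) b2 _ _] := D2 s st.
have Llin : 'd a x (t *: w + s *: v) = t * 'd a x w + 'd a x (s *: v).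
  by rewrite linearD linearZ.
rewrite Llin addrA in b2.
have -> : phi (x + t *: v + t *: w) - phi (x + t *: v) - phi (x + t *: w) + phi x = th t - th 0.
  by rewrite /th !scale0r !addr0 (addrAC x); ring.
rewrite thE subr0 /th'.
set L := 'd a x w in b1 b2 *; set L' := 'd a x (s *: v) in b1 b2 *.
set p := a (x + s *: v) in b1 b2 *.
set q := a (x + t *: w + s *: v) in b1 b2 *.
set c := a x in b1 b2 *.
have -> : (q - p) * t - t ^+ 2 * L = t * ((q - c - (t * L + L')) - (p - c - L')) by ring.
rewrite normrM gtr0_norm// expr2 mulrCA ler_pM2l// (le_trans (ler_normB _ _))//.
apply: le_trans (lerD b2 b1) _; rewrite -mulrDr.
apply: (le_trans (ler_wpM2l _ (lerD (svw _ st) (sv _ st)))).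
  by rewrite divr_ge0// ltW.
rewrite -mulrDr mulrCA [leRHS]mulrC ler_pM2l// mulrAC ler_pdivrMr// ler_pM2l//.
by rewrite addrC /M lerDl.
Qed.

(** Both sides, multiplied by [t ^+ 2], approximate the same second difference, so they differ by
    less than any [e]. *)
Lemma schwarz (V : normedModType R) (phi a b : V -> R) x v w :
  (\forall y \near x, [/\ differentiable phi y, 'd phi y v = a y & 'd phi y w = b y]) ->
  differentiable a x -> differentiable b x -> 'd a x w = 'd b x v.
Proof.
move=> dphi dv dw.
have dphi1 : \forall y \near x, differentiable phi y /\ 'd phi y v = a y.
  by apply: filterS dphi => y [].
have dphi2 : \forall y \near x, differentiable phi y /\ 'd phi y w = b y.
  by apply: filterS dphi => y [].
apply/eqP; rewrite -subr_eq0 -normr_le0.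
apply/ler_addgt0Pl => e e0; rewrite addr0.
have e20 : 0 < e / 2 by rewrite divr_gt0.
have [d1 d10 P1] := schwarz_bound _ _ _ _ _ w dphi1 dv _ e20.
have [d2 d20 P2] := schwarz_bound _ _ _ _ _ v dphi2 dw _ e20.
pose t := Num.min d1 d2 / 2.
have t0 : 0 < t by rewrite divr_gt0// lt_min d10.
have /andP[td1 td2] : (t < d1) && (t < d2).
  by rewrite -lt_min /t ltr_pdivrMr// ltr_pMr ?lt_min ?d10// ltr1n.
have {}P1 := P1 t; have {}P2 := P2 t.
rewrite t0 td1 in P1; rewrite t0 td2 (addrAC x) in P2.
have {}P1 := P1 isT; have {}P2 := P2 isT.
have t20 : 0 < t ^+ 2 by rewrite exprn_gt0.
rewrite -(ler_pM2l t20) -{1}(gtr0_norm t20) -normrM.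
move: P1 P2; rewrite !ler_norml => /andP[? ?] /andP[? ?]; apply/andP; split; lra.
Qed.

End Diff.

(** * Solvability of nonlinear equations *)

Section Linear.
Context {R : realType}.

Lemma linear_right_inverse (V W : euclideanType R) (A : {linear V -> W}) :
  range A = setT -> exists B : {linear W -> V}, forall z, A (B z) = z.
Proof.
move=> AT; exists (linfun A)^-1%VF => z.
have : z \in limg (linfun A).
  have /= : range A z by rewrite AT.
  by move=> [v _ <-]; apply/memv_imgP; exists v; rewrite ?memvf ?lfunE.
by move=> /limg_lfunVK; rewrite lfunE.
Qed.

(** A vector of the kernel has norm at most half of itself, so [G] is injective, and onto by finite
    dimension. *)
Lemma near_id_surjective (W : euclideanType R) (G : {linear W -> W}) :
  (forall z, `|G z - z| <= 2^-1 * `|z|) -> range G = setT.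
Proof.
move=> Gid.
have ker0 : lker (linfun G) == 0%VS.
  apply/lker0P => u v; rewrite !lfunE/= => Guv; apply/subr0_eq/eqP.
  have := Gid (u - v); rewrite linearB/= Guv subrr sub0r normrN -normr_eq0.
  by have := normr_ge0 (u - v) => ? ?; apply/eqP; lra.
rewrite -subTset => z _; exists ((linfun G)^-1%VF z) => //.
by have := lker0_lfunVK ker0 z; rewrite lfunE.
Qed.

(** The finite sum [S y] over a basis dominates the operator norm of the difference and tends to
    0. *)
Lemma diff_near_uniform (V : euclideanType R) (W : normedModType R) (h : V -> W) x :
  (forall v, {for x, continuous (fun y => 'd h y v)}) ->
  forall e, 0 < e -> \forall y \near x, forall v,
    `|'d h y v - 'd h x v| <= e * `|v|.
Proof.
move=> hc e e0.
pose S y := \sum_(i < \dim {:V}) `|dual_basis i : V| *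
  `|'d h y (vbasis {:V})`_i - 'd h x (vbasis {:V})`_i|.
have S0 : S @ x --> (0 : R).
  rewrite [X in _ --> X](_ : _ = \sum_(i < \dim {:V}) 0); last by rewrite big1.
  apply: cvg_big => [|i _]; first exact: add_continuous.
  rewrite -(mulr0 `|dual_basis i : V|); apply: cvgMr.
  apply/norm_cvg0P; rewrite -(subrr ('d h x (vbasis {:V})`_i)).
  by apply: cvgB; [exact: hc|exact: cvg_cst].
near=> y => v.
have E z : 'd h z v = \sum_(i < \dim {:V}) dot (dual_basis i) v *: 'd h z (vbasis {:V})`_i.
  rewrite {1}(dot_expansion v) linear_sum; apply: eq_bigr => i _.
  by rewrite linearZ.
rewrite !E -sumrB.
apply: (@le_trans _ _ (S y * `|v|)); last first.
  rewrite ler_wpM2r// (le_trans (ler_norm _))//; near: y.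
  exact: cvgr0_norm_le.
rewrite mulr_suml (le_trans (ler_norm_sum _ _ _))// ler_sum// => i _.
by rewrite -scalerBr normrZ mulrAC ler_wpM2r// normr_dot.
Unshelve. all: by end_near. Qed.

(** If [B] is a right inverse of ['d h x] bounded by [M], then ['d h y \o B] is within [1 / 2] of
    the identity as soon as ['d h y] is within [1 / (2 M)] of ['d h x]. *)
Lemma diff_near_surjective (V W : euclideanType R) (h : V -> W) x :
  (forall v, {for x, continuous (fun y => 'd h y v)}) ->
  range ('d h x) = setT -> \forall y \near x, range ('d h y) = setT.
Proof.
move=> hc /linear_right_inverse[B BK].
have [M M0 BM] := linear_bounded _ B.
have M20 : 0 < (2 * M)^-1 by rewrite invr_gt0 mulr_gt0.
near=> y.
have dy : forall v, `|'d h y v - 'd h x v| <= (2 * M)^-1 * `|v|.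
  by near: y; exact: diff_near_uniform.
have /near_id_surjective G : forall z, `|('d h y \o B) z - z| <= 2^-1 * `|z|.
  move=> z; rewrite -{2}(BK z)/= (le_trans (dy _))//.
  rewrite (le_trans (ler_wpM2l _ (BM z))) ?(ltW M20)//.
  by rewrite mulrA ler_wpM2r// invfM -mulrA mulVf ?mulr1// gt_eqF.
rewrite -subTset => z _; have : range ('d h y \o B) z by rewrite G.
by move=> [u _ <-]; exists (B u).
Unshelve. all: by end_near. Qed.

Lemma convex_comb (V : normedModType R) (A : set V) x y t :
  convex_set A -> A x -> A y -> 0 <= t <= 1 -> A (x + t *: (y - x)).
Proof.
move=> Acvx Ax Ay t01.
have t01' : Itv.spec (Itv.num_sem (R:=R)) (Itv.Real `[0%Z, 1%Z]) t.
  by apply/andP; split; rewrite ?num_real//= in_itv.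
have := Acvx y x (Itv.mk t01'); rewrite !inE/= => /(_ Ay Ax).
rewrite (_ : x + _ = t *: y + (1 - t) *: x)//.
by rewrite scalerBr scalerBl scale1r addrCA.
Qed.

End Linear.

Section Lyusternik.
Context {R : realType} {V W : euclideanType R}.

Lemma exists_min (K : set V) (f : V -> R) c x0 r :
  closed K -> K x0 -> `|x0 - c| <= r ->
  (forall x, `|x - c| <= r -> {for x, continuous f}) ->
  exists x, [/\ K x, `|x - c| <= r & forall y, K y -> `|y - c| <= r -> f x <= f y].
Proof.
move=> Kcl Kx0 x0r fc.
have cpt : compact (K `&` [set y | `|y - c| <= r]).
  by rewrite setIC; apply: compact_closedI => //; exact: closed_ball_compact.
have [||x] := compact_EVT_min _ cpt (f := f).
- by exists x0.
- by apply: continuous_in_subspaceT => x; rewrite inE => -[_]; exact: fc.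
rewrite inE => -[Kx xr] xmin; exists x; split=> // y Ky yr.
by apply: xmin; rewrite inE.
Qed.

Lemma exists_small (a b c : R) : 0 < a -> 0 < b -> 0 < c ->
  exists s, [/\ 0 < s, s <= a, s < b & s <= c].
Proof.
move=> a0 b0 c0; exists (Num.min a (Num.min (b / 2) c)); split.
- by rewrite !lt_min a0 c0 divr_gt0.
- by rewrite ge_min lexx.
- by rewrite !gt_min (_ : b / 2 < b) ?orbT//; lra.
- by rewrite !ge_min lexx !orbT.
Qed.

(* For [t] small, a minimizer of [|F y' - z| + c |y' - y0|] on a ball around
   [y0 = y + t w], with [z = F y + t F'(y) w], lies in the interior; if its residual
   [u] were nonzero, moving along [B u], with [B] a right inverse of [F'(y)], would
   decrease the objective as soon as [c] is small compared to [1 / |B|]. *)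
Lemma lyusternik (F : V -> W) U y w :
  open U -> U y -> (forall y', U y' -> differentiable F y') ->
  (forall v, {for y, continuous (fun y' => 'd F y' v)}) ->
  range ('d F y) = setT ->
  forall e, 0 < e -> exists2 d, 0 < d & forall t, 0 < t < d ->
  exists y', [/\ U y', F y' = F y + t *: 'd F y w & `|y' - (y + t *: w)| <= e * t].
Proof.
move=> Uo Uy dF dFc /linear_right_inverse[B BK] e e0.
have [M M0 BM] := linear_bounded _ B.
have M20 : 0 < (2 * M)^-1 by rewrite invr_gt0 mulr_gt0.
have : \forall y' \near y, U y' /\ forall v, `|'d F y' v - 'd F y v| <= (2 * M)^-1 * `|v|.
  near=> y'; split; first by near: y'; exact: open_nbhs_nbhs.
  by near: y'; exact: diff_near_uniform.
move=> /nbhs_normP[r /= r0 rP].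
have {}rP y' : `|y' - y| < r -> U y' /\ forall v, `|'d F y' v - 'd F y v| <= (2 * M)^-1 * `|v|.
  by rewrite distrC => /rP.
pose c := (4 * M)^-1; have c0 : 0 < c by rewrite invr_gt0 mulr_gt0.
pose m := `|w| + 1; have m0 : 0 < m by rewrite ltr_wpDl.
have wm : `|w| <= m by rewrite lerDl.
have [d1 d10 dP1] := differentiable_bound _ _ _ _ (dF _ Uy) (c * e / m) (divr_gt0 (mulr_gt0 c0 e0) m0).
have r20 : 0 < r / 2 by rewrite divr_gt0.
(* The first bound makes the expansion of [F] valid at [t *: w]; the second puts the ball of radius
   [e * t] around [y0] inside the one of radius [r / 2]; the third puts the latter inside the ball
   of radius [r] around [y]. *)
have [d [d0 dd1 de dr]] := exists_small (d1 / m) (r / 2 / e) (r / 2 / m)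
  (divr_gt0 d10 m0) (divr_gt0 r20 e0) (divr_gt0 r20 m0).
exists d => // t /andP[t0 td].
have tw : `|t *: w| <= t * m by rewrite normrZ gtr0_norm// ler_pM2l.
have twd1 : `|t *: w| < d1.
  by rewrite (le_lt_trans tw)// -ltr_pdivlMr// (lt_le_trans td).
have twr : `|t *: w| < r / 2.
  by rewrite (le_lt_trans tw)// -ltr_pdivlMr// (lt_le_trans td).
have etr : e * t < r / 2 by rewrite mulrC -ltr_pdivlMr// (lt_trans td).
set y0 := y + t *: w; set z := F y + t *: 'd F y w.
have Fy0 : `|F y0 - z| <= c * (e * t).
  have := dP1 _ twd1; rewrite -addrA -opprD linearZ/= => /le_trans; apply.
  rewrite -[leLHS]mulrA -[leLHS]mulrA ler_pM2l// ler_pM2l// ler_pdivrMl//.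
  by rewrite mulrC.
have ball_near y' : `|y' - y0| <= r / 2 -> `|y' - y| < r.
  move=> y'y0; rewrite -(subrKC y0 y') addrAC [y0 - y]addrAC subrr add0r addrC.
  by rewrite (le_lt_trans (ler_normD _ _))// (splitr r) ler_ltD.
pose phi y' := `|F y' - z| + c * `|y' - y0|.
have [| |||ys [_ ysr ysmin]] := exists_min setT phi y0 y0 (r / 2).
- exact: closedT.
- by [].
- by rewrite subrr normr0 ltW.
- move=> x /ball_near/rP[/dF/differentiable_continuous Fx _].
  apply: cvgD.
    by apply: cvg_norm; apply: cvgB => //; exact: cvg_cst.
  by apply: cvgMr; apply: cvg_norm; apply: cvgB; [exact: cvg_id|exact: cvg_cst].
(* The penalty at [ys] is at most the objective at [y0], where only the residual, at most
   [c * (e * t)], remains. *)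
have yse : `|ys - y0| <= e * t.
  rewrite -(ler_pM2l c0) (le_trans _ Fy0)//.
  have := ysmin y0 Logic.I; rewrite /phi subrr normr0 mulr0 addr0 => /(_ (ltW r20)).
  by apply: le_trans; rewrite lerDr.
have [Uys dys] := rP _ (ball_near _ ysr).
exists ys; split=> //.
apply/eqP; rewrite -subr_eq0 -normr_eq0 eq_le normr_ge0 andbT leNgt; apply/negP.
rewrite -/z distrC; set u := z - F ys => N0.
set N := `|u| in N0.
pose P := M * N; have P0 : 0 < P by rewrite mulr_gt0.
have [d3 d30 dP3] := differentiable_bound _ _ _ _ (dF _ Uys) (8 * M)^-1 ltac:(by rewrite invr_gt0 mulr_gt0).
(* [P] bounds the norm of [B u]; the last bound keeps [ys + s *: B u] in the ball on which [ys] is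
   minimal. *)
have [s [s0 s1 sd3 sr]] := exists_small 1 (d3 / P) ((r / 2 - e * t) / P)
  ltr01 (divr_gt0 d30 P0) ltac:(by rewrite divr_gt0// subr_gt0).
have sB : `|s *: B u| <= s * P by rewrite normrZ gtr0_norm// ler_pM2l.
have b1 := dP3 (s *: B u) ltac:(by rewrite (le_lt_trans sB)// -ltr_pdivlMr).
have {b1} b1 : `|F (ys + s *: B u) - F ys - 'd F ys (s *: B u)| <= s * N / 8.
  apply: (le_trans b1); apply: (le_trans (ler_wpM2l _ sB)).
    by rewrite invr_ge0 mulr_ge0// ltW.
  by rewrite /P le_eqVlt; apply/orP; left; apply/eqP; field; rewrite gt_eqF.
have b2 : `|s *: ('d F ys (B u) - u)| <= s * N / 2.
  rewrite normrZ gtr0_norm// -mulrA ler_pM2l// -{2}(BK u) (le_trans (dys _))//.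
  apply: (le_trans (ler_wpM2l (ltW M20) (BM u))).
  by rewrite le_eqVlt; apply/orP; left; apply/eqP; rewrite -/N; field; rewrite gt_eqF.
have b3 : `|(s - 1) *: u| <= (1 - s) * N.
  by rewrite normrZ distrC ger0_norm// subr_ge0.
have b4 : `|F (ys + s *: B u) - z| <= s * N / 8 + s * N / 2 + (1 - s) * N.
  rewrite (_ : F (ys + s *: B u) - z = (F (ys + s *: B u) - F ys - 'd F ys (s *: B u)) +
    s *: ('d F ys (B u) - u) + (s - 1) *: u).
    apply: le_trans (ler_normD _ _) _; apply: lerD => //.
    by apply: le_trans (ler_normD _ _) _; exact: lerD.
  rewrite linearZ/= scalerBr scalerBl scale1r.
  by rewrite [X in _ = X + _]addrA subrK addrA subrK opprB addrA subrK.
have b5 : `|ys + s *: B u - y0| <= `|ys - y0| + s * P.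
  by rewrite addrAC (le_trans (ler_normD _ _))// lerD2l.
have := ysmin (ys + s *: B u) Logic.I.
have -> : `|ys + s *: B u - y0| <= r / 2.
  by rewrite (le_trans b5)// (le_trans (lerD yse (lexx _)))// -lerBrDl -ler_pdivlMr.
move=> /(_ isT); rewrite /phi distrC -/u -/N => h.
have := le_trans h (lerD b4 (ler_wpM2l (ltW c0) b5)).
(* The residual drops by at least [3 s N / 8] and the penalty grows by at most [s N / 4],
   contradicting minimality. *)
have cP : c * (s * P) = s * N / 4 by rewrite /c /P; field; rewrite gt_eqF.
rewrite mulrDr cP; have := mulr_gt0 s0 N0; lra.
Unshelve. all: by end_near. Qed.

End Lyusternik.

(** * Normal cones *)

Section NormalCone.
Context {R : realType}.

Lemma exists_projection (V : euclideanType R) (K : set V) u :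
  K !=set0 -> closed K -> convex_set K ->
  exists y, normal_cone K y (u - y).
Proof.
move=> [x0 Kx0] Kcl Kcvx.
have [||x _|y [Ky yr ymin]] := exists_min K (fun y => `|y - u|) u x0 `|x0 - u| Kcl.
- by [].
- by [].
- by apply: cvg_norm; apply: cvgB; [exact: cvg_id|exact: cvg_cst].
exists y; split=> // z Kz.
have {}ymin z' : K z' -> `|y - u| <= `|z' - u|.
  move=> Kz'; have [/ymin->//|/ltW] := leP `|z' - u| `|x0 - u|.
  exact: le_trans.
set p := dot (u - y) (z - y); rewrite leNgt; apply/negP => p0.
have n0 : 0 < `|z - y| ^+ 2 + 1 by rewrite ltr_wpDl// sqr_ge0.
(* A step of this length from [y] towards [z] would get strictly closer to [u]; the [+ 1] keeps the
   denominator positive. *)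
have [s [s0 s1 sn _]] := @exists_small R 1 (p / (`|z - y| ^+ 2 + 1)) 1 ltr01 (divr_gt0 p0 n0) ltr01.
have /ymin : K (y + s *: (z - y)) by apply: convex_comb => //; rewrite s1 ltW.
rewrite -ler_sqr ?nnegrE// -!dot_norm.
have -> : y + s *: (z - y) - u = s *: (z - y) - (u - y) by rewrite opprB addrA (addrC y).
rewrite -(opprB u y) [X in X <= _](_ : _ = dot (u - y) (u - y)); last first.
  by rewrite dotNr dotC dotNr opprK.
have expand (a b : V) : dot b b <= dot (s *: a - b) (s *: a - b) ->
    0 <= s * (s * `|a| ^+ 2 - 2 * dot b a).
  by rewrite -(dot_norm a) dotBl !dotBr !dotZl !dotZr (dotC a b) mulrBr; lra.
move/expand; rewrite -/p => h.
rewrite pmulr_rge0// in h.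
rewrite ltr_pdivlMr// mulrDr in sn; lra.
Qed.

(** Testing the normal inequality at [2 z] and at 0 gives orthogonality; the other points then give
    polarity. *)
Lemma cone_normal (V : euclideanType R) (D : set V) z mu :
  pointed_closed_convex_cone D -> normal_cone D z mu ->
  dot mu z = 0 /\ forall d, D d -> dot mu d <= 0.
Proof.
move=> [_ _ D0 Dsc _] [Dz Nz].
have z0 : dot mu z = 0.
  apply/eqP; rewrite eq_le; apply/andP; split.
    have := Nz _ (Dsc 2 z ltac:(by []) Dz); rewrite dotBr dotZr; lra.
  by have := Nz _ D0; rewrite sub0r dotNr; lra.
by split=> // d /Nz; rewrite dotBr z0 subr0.
Qed.

(** As [Xi y = 0], the difference quotients of [Xi] along points of [K] eventually lie in the closed
    cone [D]. *)
Lemma contingent_cone_reduction (V Z : euclideanType R) (K : set V) y U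
    (Xi : V -> Z) D w :
  C2_reduction K y U Xi D -> contingent_cone K y w -> D ('d Xi y w).
Proof.
move=> red [t [w_ [t0 tc wc Kt]]].
have dXi : differentiable Xi y by case: (red_C2 red (red_nbhs red)).
have tn0 : \forall k \near \oo, t k != 0 by apply: nearW => k; rewrite gt_eqF.
have := cvg_difference_quotient _ _ _ _ _ \oo _ _ _ dXi tn0 tc wc.
move=> /(_ _) cvXi; apply: (closed_cvg _ (cone_closed (red_cone red)) _ _ cvXi).
have yc : (fun k => y + t k *: w_ k) @ \oo --> y.
  rewrite -[X in _ --> X]addr0; apply: cvgD; first exact: cvg_cst.
  by rewrite -(scale0r w); exact: cvgZ.
have : \forall k \near \oo, U (y + t k *: w_ k).
  by apply: yc; apply: open_nbhs_nbhs; split; [exact: red_open red|exact: red_nbhs red].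
apply: filterS => k Uk; apply: (cone_scale (red_cone red)); first by rewrite invr_gt0.
rewrite (red0 red) subr0.
have : (K `&` U) (y + t k *: w_ k) by [].
by rewrite (red_eq red) => -[].
Qed.

(** [lyusternik] lifts a direction [w] with [Xi y + Xi'(y) w] in [D] to points [y + t w + o(t)] of
    [K], so [lambda] is nonpositive on such directions. It thus vanishes on the kernel of [Xi'(y)]
    and factors through it. [Xi y = 0] is not assumed, so that the result applies around the
    reference point. *)
Lemma normal_cone_reduction (V Z : euclideanType R) (K : set V) U
    (Xi : V -> Z) D y lambda :
  open U -> U y -> (forall y', U y' -> differentiable Xi y') ->
  (forall v, {for y, continuous (fun y' => 'd Xi y' v)}) ->
  range ('d Xi y) = setT -> convex_set D -> K `&` U = U `&` Xi @^-1` D ->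
  normal_cone K y lambda ->
  exists mu, normal_cone D (Xi y) mu /\
    forall v, dot lambda v = dot mu ('d Xi y v).
Proof.
move=> Uo Uy dXi dXic onto Dcvx KU [Ky Nl].
have DXi : D (Xi y) by have : (K `&` U) y by []; rewrite KU => -[].
have claim w : D (Xi y + 'd Xi y w) -> dot lambda w <= 0.
  move=> Dw; apply/ler_addgt0Pr => e e0; rewrite add0r.
  have l0 : 0 < `|lambda| + 1 by rewrite ltr_wpDl.
  have [d d0 dP] := lyusternik Xi U y w Uo Uy dXi dXic onto _ (divr_gt0 e0 l0).
  have [t [t0 t1 td _]] := exists_small 1 d 1 ltr01 d0 ltr01.
  have [|y' [Uy' Xiy' y'e]] := dP t; first by rewrite t0.
  have Ky' : K y'.
    have : (U `&` Xi @^-1` D) y'.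
      split=> //=; rewrite Xiy'.
      (* The target value lies on the segment between two points of the convex set [D]. *)
      have -> : 'd Xi y w = Xi y + 'd Xi y w - Xi y by rewrite addrAC subrr add0r.
      by apply: convex_comb => //; rewrite (ltW t0).
    by rewrite -KU => -[].
  have := Nl _ Ky'.
  have -> : y' - y = (y' - (y + t *: w)) + t *: w by rewrite opprD addrA subrK.
  rewrite dotDr dotZr => h.
  have : `|dot lambda (y' - (y + t *: w))| <= e * t.
    rewrite (le_trans (normr_dot _ _))// (le_trans (ler_wpM2l _ y'e))//.
    rewrite mulrA ler_pM2r// mulrCA ler_piMr ?(ltW e0)// ler_pdivrMr// mul1r.
    by rewrite lerDl.
  rewrite ler_norml => /andP[h1 h2].
  rewrite -(ler_pM2l t0); lra.
have [B BK] := linear_right_inverse _ _ _ onto.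
exists (adjoint B lambda); split.
  split=> // z Dz; rewrite adjointP; apply: claim.
  by rewrite BK addrCA subrr addr0.
have ker w : 'd Xi y w = 0 -> dot lambda w = 0.
  move=> w0; apply/eqP; rewrite eq_le claim ?w0 ?addr0//=.
  by rewrite -oppr_le0 -dotNr claim// linearN/= w0 oppr0 addr0.
move=> v; rewrite adjointP; apply/subr0_eq; rewrite -dotBr; apply: ker.
by rewrite linearB/= BK subrr.
Qed.

End NormalCone.

(** * Quadratic forms and symmetry of second derivatives *)

Section Quadratic.
Context {R : realType} {V : euclideanType R} (Q : V -> V).
Hypothesis Qsym : forall v w, dot (Q v) w = dot (Q w) v.

(** Linearity need not be assumed: by symmetry [dot (Q v) u] equals [dot (Q u) v], which is linear
    in [v]. *)
Lemma selfadjoint_additive v w : Q (v - w) = Q v - Q w.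
Proof.
by apply: dot_inj => u; rewrite Qsym dotBr dotBl !(Qsym u).
Qed.

Lemma quadratic_bound : exists2 M, 0 < M & forall v, `|dot (Q v) v| <= M * `|v| ^+ 2.
Proof.
exists (1 + \sum_(i < \dim {:V}) `|dual_basis i : V| * `|Q (vbasis {:V})`_i|).
  by rewrite ltr_pwDl// sumr_ge0// => i _; rewrite mulr_ge0.
move=> v; rewrite mulrDl mul1r -[leLHS]add0r lerD ?sqr_ge0//.
rewrite {2}(dot_expansion v) linear_sum/= mulr_suml.
rewrite (le_trans (ler_norm_sum _ _ _))// ler_sum// => i _.
rewrite dotZr normrM Qsym expr2 mulrACA ler_pM// ?normr_dot//.
Qed.

Lemma gradient_quadratic h : gradient (fun v => dot (Q v) v) h = 2 *: Q h.
Proof.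
apply: dot_inj => w; rewrite gradientP.
have [M M0 QM] := quadratic_bound.
suff -> : 'd (fun v => dot (Q v) v) h = (fun w => dot (2 *: Q h) w) :> (V -> R) by [].
apply: diff_eq_bound => e e0; exists (e / M); first exact: divr_gt0.
move=> v vd.
have QD : Q (h + v) = Q h + Q v.
  by apply: dot_inj => u; rewrite Qsym dotDr dotDl !(Qsym u).
rewrite /= QD dotZl !(dotDl, dotDr) (Qsym v h).
rewrite (_ : _ - _ - _ = dot (Q v) v); last by ring.
rewrite (le_trans (QM v))// expr2 mulrA ler_wpM2r//.
by rewrite mulrC -ler_pdivlMr// ltW.
Qed.

End Quadratic.

Section DiffDot.
Context {R : realType}.

Lemma differentiable_dot (V : normedModType R) (W : euclideanType R) (h : V -> W) u x :
  differentiable h x -> differentiable (fun y => dot u (h y)) x.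
Proof.
move=> dh; apply: (differentiable_comp dh).
exact/linear_differentiable/continuous_dotr.
Qed.

Lemma diff_dot (V : normedModType R) (W : euclideanType R) (h : V -> W) u x v :
  differentiable h x -> 'd (fun y => dot u (h y)) x v = dot u ('d h x v).
Proof.
move=> dh; rewrite (diff_comp dh (g := dot u))/=.
  by rewrite diff_lin//; exact: continuous_dotr.
exact/linear_differentiable/continuous_dotr.
Qed.

Lemma diff2_dot_sym (V : normedModType R) (W : euclideanType R) (h : V -> W) U x u v w :
  open U -> U x -> C2_on U h ->
  dot u (diff2 h x v w) = dot u (diff2 h x w v).
Proof.
move=> Uo Ux hC2; have [dx d2x _] := hC2 x Ux.
rewrite /diff2 -!diff_dot//.
apply: (schwarz _ (fun y => dot u (h y))); last 2 first.
- exact: differentiable_dot.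
- exact: differentiable_dot.
have : \forall y \near x, U y by exact: open_nbhs_nbhs.
apply: filterS => y /hC2[dy _ _]; split; first exact: differentiable_dot.
- exact: diff_dot.
- exact: diff_dot.
Qed.

End DiffDot.

(** * Multipliers through a cone reduction *)

Section Reduction.
Context {R : realType} {V Z : euclideanType R}.
Variables (K U : set V) (y0 lambda0 : V) (Xi : V -> Z) (D : set Z) (mu : Z).
Hypothesis red : C2_reduction K y0 U Xi D.
Hypothesis mu_normal : normal_cone D (Xi y0) mu.

Let A := 'd Xi y0.
Hypothesis lambda0E : forall v, dot lambda0 v = dot mu (A v).
Let C := critical_cone K y0 lambda0.

(** Half the gradient of [Upsilon] at [v], as [gradient_Upsilon] shows; its linearity in [v] comes
    from [curvature_sym]. *)
Definition curvature (v : V) : V := adjoint ('d (fun y => 'd Xi y v) y0) mu.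

Lemma curvatureE v w : dot (curvature v) w = dot mu (diff2 Xi y0 v w).
Proof. exact: adjointP. Qed.

Lemma curvature_sym v w : dot (curvature v) w = dot (curvature w) v.
Proof.
rewrite [LHS]curvatureE [RHS]curvatureE; apply: (diff2_dot_sym _ _ Xi U).
- exact: red_open red.
- exact: red_nbhs red.
- exact: red_C2 red.
Qed.

Lemma gradient_Upsilon h : 2^-1 *: gradient (Upsilon Xi y0 mu) h = curvature h.
Proof.
have -> : Upsilon Xi y0 mu = fun v => dot (curvature v) v.
  by apply/funext => v; rewrite curvatureE.
rewrite gradient_quadratic; last exact: curvature_sym.
by rewrite scalerA mulVf// scale1r.
Qed.

Lemma reduced_multiplier : \forall y \near y0, forall lambda,
  normal_cone K y lambda -> exists m, normal_cone D (Xi y) m /\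
    forall v, dot lambda v = dot m ('d Xi y v).
Proof.
have dXi y : U y -> differentiable Xi y by move=> /(red_C2 red)[].
have dXic y : U y -> forall v, {for y, continuous (fun y' => 'd Xi y' v)}.
  move=> /(red_C2 red)[_ d2 _] v.
  exact: differentiable_continuous.
have U0 := red_nbhs red; have Uo := red_open red.
have surj : \forall y \near y0, range ('d Xi y) = setT.
  by apply: diff_near_surjective; [exact: dXic|exact: red_onto red].
near=> y => lambda.
have Uy : U y by near: y; exact: open_nbhs_nbhs.
apply: (normal_cone_reduction _ _ _ U) => //; first exact: dXic.
- by near: y; exact: surj.
- exact: cone_convex (red_cone red).
- exact: red_eq red.
Unshelve. all: by end_near. Qed.

(** With [d = m k - mu] and [B] a right inverse of [A], [|d|^2] is [<lambda k - lambda0, B d>] up to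
    two errors governed by ['d Xi (y k) - A]. The error containing [d] a second time is absorbed in
    the left side, so no prior bound on [m] is required. *)
Lemma reduced_multiplier_cvg (y lambda : nat -> V) (m : nat -> Z) :
  y @ \oo --> y0 -> lambda @ \oo --> lambda0 ->
  (\forall k \near \oo, forall v, dot (lambda k) v = dot (m k) ('d Xi (y k) v)) ->
  m @ \oo --> mu.
Proof.
move=> yc lc lE.
have [_ d2 _] := red_C2 red (red_nbhs red).
have dXic v : {for y0, continuous (fun y' => 'd Xi y' v)} by exact: differentiable_continuous.
have [B BK] := linear_right_inverse _ _ _ (red_onto red).
have [M M0 BM] := linear_bounded _ B.
apply/cvgrPdist_le => e e0.
have mu1 : 0 < `|mu| + 1 by rewrite ltr_wpDl.
(* The first bound makes the absorbed error at most [|d|^2 / 2], the last one makes the error with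
   [mu] at most [e |d| / 4]. *)
have [eta [eta0 eta1 _ eta2]] := @exists_small R (2 * M)^-1 1 (e / (4 * M * (`|mu| + 1)))
  ltac:(by rewrite invr_gt0 mulr_gt0) ltr01 ltac:(by rewrite divr_gt0// !mulr_gt0).
have H : \forall k \near \oo, forall v, `|'d Xi (y k) v - A v| <= eta * `|v|.
  exact: (yc _ (diff_near_uniform _ _ Xi y0 dXic eta eta0)).
near=> k.
have lk : `|lambda0 - lambda k| <= e / (4 * M).
  by near: k; move/cvgrPdist_le: lc; apply; rewrite divr_gt0// mulr_gt0.
have dk v : `|'d Xi (y k) v - A v| <= eta * `|v|.
  by move: v; near: k; exact: H.
have lEk v : dot (lambda k) v = dot (m k) ('d Xi (y k) v) by move: v; near: k; exact: lE.
rewrite distrC; set d := m k - mu.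
have E : dot d d = dot (lambda k - lambda0) (B d) - dot mu ('d Xi (y k) (B d) - A (B d))
   - dot d ('d Xi (y k) (B d) - A (B d)).
  rewrite dotBl lEk lambda0E !dotBr /A BK.
  have -> : m k = d + mu by rewrite /d subrK.
  by rewrite !dotDl; ring.
have Bd : `|'d Xi (y k) (B d) - A (B d)| <= eta * M * `|d|.
  by rewrite (le_trans (dk _))// -mulrA ler_pM2l.
have b1 : dot (lambda k - lambda0) (B d) <= e / 4 * `|d|.
  rewrite (le_trans (ler_norm _))// (le_trans (normr_dot _ _))// distrC.
  apply: (le_trans (ler_pM _ _ lk (BM _))) => //.
  by rewrite mulrA invfM mulrA divfK// gt_eqF.
have b2 : - dot mu ('d Xi (y k) (B d) - A (B d)) <= e / 4 * `|d|.
  rewrite -dotNr (le_trans (ler_norm _))// (le_trans (normr_dot _ _))// normrN.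
  apply: (le_trans (ler_pM _ _ (_ : _ <= `|mu| + 1) Bd)) => //; first by rewrite lerDl.
  rewrite !mulrA ler_wpM2r//.
  move: eta2; rewrite ler_pdivlMr ?mulr_gt0// => h.
  by rewrite ler_pdivlMr//; apply: le_trans h; rewrite le_eqVlt; apply/orP; left; apply/eqP; ring.
have b3 : - dot d ('d Xi (y k) (B d) - A (B d)) <= 2^-1 * `|d| * `|d|.
  rewrite -dotNr (le_trans (ler_norm _))// (le_trans (normr_dot _ _))// normrN.
  rewrite mulrC ler_wpM2r// (le_trans Bd)// ler_wpM2r//.
  by rewrite -ler_pdivlMr// -invfM.
have := dot_norm d; rewrite E expr2 => E2.
have [d0|d0] := eqVneq `|d| 0; first by rewrite d0 ltW.
have dp : 0 < `|d| by rewrite lt_neqAle eq_sym d0/=.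
rewrite -(ler_pM2r dp); lra.
Unshelve. all: by end_near. Qed.

(* [nu k] is the adjoint of [A] applied to [(m k - mu) / t k], where [m k] is the
   reduced multiplier of [lambda k]. The sequence [v] replaces [h] in the sign
   condition because [nu] need not be bounded. *)
Lemma normal_cone_sequence (t : nat -> R) (y lambda : nat -> V) h :
  normal_cone K y0 lambda0 ->
  (forall k, 0 < t k) -> t @ \oo --> (0 : R) ->
  (forall k, normal_cone K (y k) (lambda k)) ->
  (fun k => (t k)^-1 *: (y k - y0)) @ \oo --> h -> lambda @ \oo --> lambda0 ->
  C h /\ exists nu v : nat -> V,
    [/\ \forall k \near \oo, polar C (nu k) /\ 0 <= dot (nu k) (v k),
        v @ \oo --> h &
        (fun k => (t k)^-1 *: (lambda k - lambda0) - nu k) @ \oo --> curvature h].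
Proof.
move=> [Ky0 N0] t0 tc Nk wc lc.
pose w k := (t k)^-1 *: (y k - y0).
have yE k : y k = y0 + t k *: w k.
  by rewrite /w scalerA mulfV ?gt_eqF// scale1r addrC subrK.
have tn0 : \forall k \near \oo, t k != 0 by apply: nearW => k; rewrite gt_eqF.
have yc : y @ \oo --> y0.
  rewrite (_ : y = fun k => y0 + t k *: w k); last exact/funext.
  rewrite -[X in _ --> X]addr0; apply: cvgD; first exact: cvg_cst.
  by rewrite -(scale0r h); exact: cvgZ.
have hT : contingent_cone K y0 h.
  by exists t, w; split=> // k; rewrite -yE; case: (Nk k).
have hC : C h.
  (* One inequality tests [lambda0] at [y k], the other tests [lambda k] at [y0]. *)
  split=> //=; apply/eqP; rewrite eq_le; apply/andP; split.
    apply: (closed_cvg _ (@closed_le R 0) _ _ (cvg_dot _ _ _ _ _ _ (cvg_cst lambda0) wc)).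
    apply: nearW => k; rewrite /= dotZr pmulr_rle0 ?invr_gt0//.
    by apply: N0; case: (Nk k).
  apply: (closed_cvg _ (@closed_ge R 0) _ _ (cvg_dot _ _ _ _ _ _ lc wc)).
  apply: nearW => k; rewrite /= dotZr pmulr_rge0 ?invr_gt0//.
  case: (Nk k) => _ /(_ _ Ky0); rewrite -(opprB (y k)) dotNr; lra.
split=> //.
have DC := cone_normal _ _ _ _ (red_cone red).
have [_ muD] := DC _ _ mu_normal.
pose P k m := normal_cone D (Xi (y k)) m /\
  forall v, dot (lambda k) v = dot m ('d Xi (y k) v).
(* Reduced multipliers exist only for large [k]; elsewhere [m k] may be anything. *)
have [m mP] : exists m : nat -> Z, forall k, (exists m', P k m') -> P k (m k).
  suff /choice[m mP] : forall k, exists m, (exists m', P k m') -> P k m by exists m.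
  move=> k.
  have [[m Pm]|nP] := pselect (exists m', P k m'); first by exists m.
  by exists 0.
have {}mP : \forall k \near \oo, P k (m k).
  have : \forall k \near \oo, forall lambda, normal_cone K (y k) lambda ->
      exists m, normal_cone D (Xi (y k)) m /\ forall v, dot lambda v = dot m ('d Xi (y k) v).
    exact: (yc _ reduced_multiplier).
  by apply: filterS => k H; apply: mP; exact: H.
have mc : m @ \oo --> mu.
  by apply: (reduced_multiplier_cvg _ _ _ yc lc); apply: filterS mP => k [].
have [B BK] := linear_right_inverse _ _ _ (red_onto red).
exists (fun k => adjoint A ((t k)^-1 *: (m k - mu))).
(* The correction by [B] makes [A (v k)] exactly [Xi (y k) / t k], so that [<nu k, v k>] is
   [- <mu, Xi (y k)> / (t k)^2], which is nonnegative. *)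
exists (fun k => h + B ((t k)^-1 *: (Xi (y k) - Xi y0) - A h)).
have [dXi d2Xi _] := red_C2 red (red_nbhs red).
split.
- apply: filterS mP => k [NDk _]; have [z0 mD] := DC _ _ NDk.
  have Dk : D (Xi (y k)) by case: NDk.
  split.
    move=> u [uT uO]; rewrite adjointP dotZl pmulr_rle0 ?invr_gt0// dotBl.
    rewrite /= lambda0E in uO; rewrite uO subr0.
    by apply: mD; exact: contingent_cone_reduction red uT.
  rewrite adjointP /A (linearD ('d Xi y0))/= BK addrCA subrr addr0.
  rewrite dotZl dotZr !pmulr_rge0 ?invr_gt0// (red0 red) subr0 dotBl z0 sub0r.
  by rewrite oppr_ge0 muD.
- have q0 : (fun k => (t k)^-1 *: (Xi (y k) - Xi y0) - A h) @ \oo --> (0 : Z).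
    rewrite -[X in _ --> X](subrr (A h)); apply: cvgB; last exact: cvg_cst.
    have /(_ _) := cvg_difference_quotient _ _ _ _ _ \oo _ _ _ dXi tn0 tc wc.
    by under eq_fun do rewrite -/(w _) -yE.
  have := cvg_comp _ _ q0 (linear_continuous_fd _ B 0); rewrite linear0 => Bq0.
  by rewrite -[X in _ --> X]addr0; apply: cvgD; [exact: cvg_cst|exact: Bq0].
(* Paired with [u], the difference equals [<m k, ('d Xi (y k) u - A u) / t k>]. *)
- apply: cvg_dotP => u; rewrite curvature_sym curvatureE.
  have dq : (fun k => (t k)^-1 *: ('d Xi (y k) u - A u)) @ \oo --> diff2 Xi y0 u h.
    have /(_ _) := cvg_difference_quotient _ _ _ _ _ \oo _ _ _ (d2Xi u) tn0 tc wc.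
    by under eq_fun do rewrite -/(w _) -yE.
  apply: cvg_trans (cvg_dot _ _ _ _ _ _ mc dq); apply: near_eq_cvg.
  apply: filterS mP => k [_ lE].
  rewrite dotBl adjointP !dotZl !dotZr dotBl lE lambda0E dotBl dotBr -/A; ring.
Qed.

End Reduction.

(** * Graphical derivative of the normal cone mapping *)

Lemma cvg_polar (R : realType) (V : euclideanType R) (C : set V) (nu : nat -> V) z :
  (\forall k \near \oo, polar C (nu k)) -> nu @ \oo --> z -> polar C z.
Proof.
move=> Cnu nuz w Cw.
apply: (closed_cvg _ (@closed_le R 0) _ _ (cvg_dot _ _ _ _ _ _ nuz (cvg_cst w))).
by apply: filterS Cnu => k; exact.
Qed.

Lemma cvg_natSinv (R : realType) : (fun k : nat => k.+1%:R^-1 : R) @ \oo --> (0 : R).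
Proof.
apply/cvgr0Pnorm_lt => e e0; near=> k.
rewrite ger0_norm ?invr_ge0//; near: k.
exact: (near_infty_natSinv_lt (PosNum e0)).
Unshelve. all: by end_near. Qed.

Lemma prox_identity (R : realType) (V : euclideanType R) (s : R) (h w z q r : V) :
  s != 0 ->
  s *: (s^-1 *: (h + s *: (z + q) - w) - r - z) = h - w + s *: (q - r).
Proof.
move=> s0; apply: dot_inj => a; rewrite !(dotBl, dotDl, dotZl).
by field.
Qed.

Section GraphicalDerivative.
Context {R : realType} {V Z : euclideanType R}.
Variables (K U : set V) (y0 lambda0 : V) (Xi : V -> Z) (D : set Z) (mu : Z).
Hypotheses (K_closed : closed K) (K_convex : convex_set K).
Hypothesis red : C2_reduction K y0 U Xi D.
Hypothesis mu_normal : normal_cone D (Xi y0) mu.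

Hypothesis lambda0E : forall v, dot lambda0 v = dot mu ('d Xi y0 v).
Let C := critical_cone K y0 lambda0.
Let Q := curvature y0 Xi mu.

Hypothesis lambda0_normal : normal_cone K y0 lambda0.

(** A limit [ws] of the quotients of projections satisfies [p = ws + s (zs + Q ws)] with [ws] in
    [C], [zs] in its polar and [<zs, ws> >= 0], while [p = h + s (zeta + Q h)]. Subtracting and
    pairing with [e = h - ws] gives [|e|^2 + s <Q e, e> <= 0], hence [e = 0]. *)
Lemma graphical_derivative_normal_cone h zeta :
  C h -> polar C zeta -> dot zeta h = 0 ->
  graphical_derivative (normal_cone K) y0 lambda0 h (zeta + Q h).
Proof.
move=> Ch Czeta zh0.
have Qsym := curvature_sym _ _ _ _ _ mu red; rewrite -/Q in Qsym.
have [M M0 QM] := quadratic_bound Q Qsym.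
(* With [s * M = 1 / 2], [|e|^2 + s <Q e, e>] is at least [|e|^2 / 2]. *)
pose s := (2 * M)^-1; have s0 : 0 < s by rewrite invr_gt0 mulr_gt0.
have sn0 : s != 0 by rewrite gt_eqF.
pose p := h + s *: (zeta + Q h).
pose t k : R := k.+1%:R^-1.
have t0 k : 0 < t k by rewrite invr_gt0.
have tc : t @ \oo --> (0 : R) by exact: cvg_natSinv.
have Kn0 : K !=set0 by exists y0; case: lambda0_normal.
pose u k := y0 + s *: lambda0 + t k *: p.
have /choice[y yP] k : exists y, normal_cone K y (u k - y) by exact: exists_projection.
pose w k := (t k)^-1 *: (y k - y0).
have yE k : y k = y0 + t k *: w k.
  by rewrite /w scalerA mulfV ?gt_eqF// scale1r addrC subrK.
have uyE k : u k - y k = s *: lambda0 + t k *: (p - w k).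
  by rewrite yE /u scalerBr opprD addrACA [y0 + _]addrC addrK.
(* Projections are nonexpansive, and [y0 + s *: lambda0] projects onto [y0]. *)
have wp k : `|w k| <= `|p|.
  have [Ky0 N0] := lambda0_normal; have [Kyk Nk] := yP k.
  have h1 := Nk _ Ky0; have {N0} h2 := N0 _ Kyk.
  have E1 := uyE k.
  have E2 : y0 - y k = - t k *: w k by rewrite yE opprD addrA subrr add0r scaleNr.
  have E3 : y k - y0 = t k *: w k by rewrite -opprB E2 scaleNr opprK.
  move: (w k) E1 E2 E3 => wk E1 E2 E3.
  rewrite E1 E2 dotDl !dotZl !dotZr dotBl in h1; rewrite E3 dotZr in h2.
  have : 0 <= t k * t k * (dot p wk - dot wk wk).
    have := mulr_ge0_le0 (ltW s0) h2; lra.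
  rewrite pmulr_rge0 ?mulr_gt0// subr_ge0 dot_norm => /le_trans/(_ (ler_norm _)).
  move=> /le_trans/(_ (normr_dot _ _)); rewrite expr2.
  have [->//|wn0] := eqVneq `|wk| 0.
  by rewrite ler_pM2r// lt_neqAle eq_sym wn0/=.
have [sg [ws [sgc wc]]] := bounded_subseq w `|p| wp.
pose lam k := s^-1 *: (u k - y k).
have lamE k : lam k - lambda0 = t k *: (s^-1 *: (p - w k)).
  rewrite /lam uyE scalerDr !scalerA mulVf// scale1r addrAC subrr add0r.
  by rewrite mulrC.
have tlamE k : (t k)^-1 *: (lam k - lambda0) = s^-1 *: (p - w k).
  by rewrite lamE scalerA mulVf ?scale1r// gt_eqF.
have lamN k : normal_cone K (y k) (lam k).
  have [Kyk Nk] := yP k; split=> // z /Nk hz.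
  by rewrite /lam dotZl pmulr_rle0 // invr_gt0.
have tsc : t \o sg @ \oo --> (0 : R) by exact: cvg_comp sgc tc.
have qc : (fun k => s^-1 *: (p - w (sg k))) @ \oo --> s^-1 *: (p - ws).
  by apply: cvgZ; [exact: cvg_cst|apply: cvgB; [exact: cvg_cst|exact: wc]].
have lamc : lam \o sg @ \oo --> lambda0.
  rewrite (_ : lam \o sg = fun k => lambda0 + t (sg k) *: (s^-1 *: (p - w (sg k)))).
    rewrite -[X in _ --> X]addr0; apply: cvgD; first exact: cvg_cst.
    by rewrite -(scale0r (s^-1 *: (p - ws))); exact: cvgZ.
  by apply/funext => k /=; rewrite -lamE addrC subrK.
have [Cws [nu [v [nuP vc nuc]]]] := normal_cone_sequence _ _ _ _ _ _ _ red mu_normal lambda0E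
  (t \o sg) (y \o sg) (lam \o sg) ws lambda0_normal (fun k => t0 (sg k)) tsc
  (fun k => lamN (sg k)) wc lamc.
pose zs := s^-1 *: (p - ws) - Q ws.
have nuzs : nu @ \oo --> zs.
  rewrite (_ : nu = fun k => s^-1 *: (p - w (sg k)) -
      (((t \o sg) k)^-1 *: ((lam \o sg) k - lambda0) - nu k)).
    by apply: cvgB.
  by apply/funext => k /=; rewrite tlamE opprB addrCA subrr addr0.
have Czs : polar C zs by apply: (cvg_polar _ _ _ nu _ _ nuzs); apply: filterS nuP => k [].
have zsws : 0 <= dot zs ws.
  apply: (closed_cvg _ (@closed_ge R 0) _ _ (cvg_dot _ _ _ _ _ _ nuzs vc)).
  by apply: filterS nuP => k [].
have {zsws Czs} hws : h = ws.
  pose e := h - ws; apply/subr0_eq/eqP; rewrite -/e -normr_eq0.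
  have Ee : s *: (zs - zeta) = e + s *: Q e.
    by rewrite /zs /p /e (selfadjoint_additive _ Qsym); exact: prox_identity.
  have := congr1 (fun z => dot z e) Ee; rewrite /= dotDl !dotZl dot_norm => E.
  have : dot (zs - zeta) e <= 0.
    rewrite /e dotBl !dotBr zh0.
    have := Czs _ Ch; have := Czeta _ Cws; lra.
  move=> /(mulr_ge0_le0 (ltW s0)); rewrite E.
  have /andP[h1 _] : - (M * `|e| ^+ 2) <= dot (Q e) e <= M * `|e| ^+ 2.
    by rewrite -ler_norml.
  have sM : s * M = 2^-1 by rewrite /s; field; rewrite gt_eqF.
  have {}h1 : - (2^-1 * `|e| ^+ 2) <= s * dot (Q e) e.
    by rewrite -sM -mulrA -mulrN ler_pM2l.
  move=> h2; have : `|e| ^+ 2 <= 0 by lra.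
  by move=> h3; rewrite -sqrf_eq0 eq_le h3 sqr_ge0.
exists (t \o sg), (fun k => (w (sg k), s^-1 *: (p - w (sg k)))); split=> //.
- by move=> k; exact: t0.
- apply: cvg_pair; first by rewrite hws; exact: wc.
  rewrite (_ : zeta + Q h = s^-1 *: (p - ws)); first exact: qc.
  by rewrite -hws /p addrAC subrr add0r scalerA mulVf// scale1r.
- move=> k /=; rewrite -yE -lamE.
  by rewrite [lambda0 + _]addrC subrK; exact: lamN.
Qed.

End GraphicalDerivative.

(** * KKT points *)

Section Lagrangian.
Context {R : realType} {X Y : euclideanType R}.
Variables (f : X -> R) (g : X -> Y).
Hypotheses (f_C2 : C2_on [set: X] f) (g_C2 : C2_on [set: X] g).

Lemma diff_lagrangian lambda x v :
  'd (lagrangian f g lambda) x v = 'd f x v + dot lambda ('d g x v).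
Proof.
have [df _ _] := f_C2 x Logic.I; have [dg _ _] := g_C2 x Logic.I.
rewrite -(diff_dot _ _ _ lambda _ v dg).
by rewrite (diffD df (differentiable_dot _ _ _ lambda _ dg)).
Qed.

Lemma differentiable_diff_lagrangian lambda x v :
  differentiable (fun x => 'd (lagrangian f g lambda) x v) x.
Proof.
under eq_fun do rewrite diff_lagrangian.
have [_ df _] := f_C2 x Logic.I; have [_ dg _] := g_C2 x Logic.I.
by apply: differentiableD => //; exact: differentiable_dot.
Qed.

(** [C2_on] speaks of derivatives along fixed vectors; these are the coefficients of the gradient in
    the dual basis. *)
Lemma differentiable_gradient_lagrangian lambda x :
  differentiable (gradient (lagrangian f g lambda)) x.
Proof.
have -> : gradient (lagrangian f g lambda) = \sum_(i < \dim {:X})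
    (fun x => 'd (lagrangian f g lambda) x (vbasis {:X})`_i *: (dual_basis i : X)).
  apply/funext => z; rewrite fct_sumE [LHS]dual_expansion.
  by apply: eq_bigr => i _; rewrite gradientP.
apply: differentiable_sum => i; apply: differentiableZl.
exact: differentiable_diff_lagrangian.
Qed.

Lemma dot_hessian_lagrangian lambda x v w :
  dot (hessian (lagrangian f g lambda) x w) v =
  'd (fun x => 'd (lagrangian f g lambda) x v) x w.
Proof.
rewrite dotC -diff_dot; last exact: differentiable_gradient_lagrangian.
by under eq_fun do rewrite dotC gradientP.
Qed.

End Lagrangian.

Lemma ler_pair_norml (R : realType) (V W : euclideanType R) (x : V) (y : W) :
  `|x| <= pair_norm x y.
Proof.
by rewrite -[leLHS]ger0_norm// -[leLHS]sqrtr_sqr ler_wsqrtr// lerDl sqr_ge0.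
Qed.

Lemma ler_pair_normr (R : realType) (V W : euclideanType R) (x : V) (y : W) :
  `|y| <= pair_norm x y.
Proof.
by rewrite -[leLHS]ger0_norm// -[leLHS]sqrtr_sqr ler_wsqrtr// lerDr sqr_ge0.
Qed.

Section KKTLimit.
Context {R : realType} {X Y Z : euclideanType R}.
Variables (f : X -> R) (g : X -> Y) (K : set Y).
Hypotheses (f_C2 : C2_on [set: X] f) (g_C2 : C2_on [set: X] g).
Hypotheses (K_closed : closed K) (K_convex : convex_set K).
Variables (xbar : X) (lbar : Y) (U : set Y) (Xi : Y -> Z) (D : set Z) (mu : Z).
Hypothesis lbarE : forall v, dot lbar v = dot mu ('d Xi (g xbar) v).
Hypothesis KKT : S_KKT f g K 0 0 (xbar, lbar).
Hypothesis red : C2_reduction K (g xbar) U Xi D.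
Hypothesis mu_normal : normal_cone D (Xi (g xbar)) mu.
Hypothesis Sigma_Gamma : forall xi zeta,
  (Sigma_set f g (Upsilon Xi (g xbar) mu) xbar lbar
     `&` Gamma_set g K xbar lbar) (xi, zeta) ->
  0 <= dot ('d g xbar xi) zeta.
Hypothesis image_closed :
  closed (adjoint ('d g xbar) @` polar (critical_cone K (g xbar) lbar)).
Hypothesis lbar_noncritical : noncritical f g K xbar lbar.

Lemma KKT_limit_eq0 (t : nat -> R) (a x : nat -> X) (b lambda : nat -> Y) xi :
  (forall k, 0 < t k) -> t @ \oo --> (0 : R) ->
  (fun k => (t k)^-1 *: a k) @ \oo --> (0 : X) ->
  (fun k => (t k)^-1 *: b k) @ \oo --> (0 : Y) ->
  lambda @ \oo --> lbar ->
  (fun k => (t k)^-1 *: (x k - xbar)) @ \oo --> xi ->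
  (forall k, S_KKT f g K (a k) (b k) (x k, lambda k)) ->
  xi = 0.
Proof.
move=> t0 tc ac bc lc wc kkt.
have [/= gradL0 Nlbar] := KKT; rewrite subr0 in Nlbar.
have [dg d2g _] := g_C2 xbar Logic.I.
pose w k := (t k)^-1 *: (x k - xbar).
have xE k : x k = xbar + t k *: w k.
  by rewrite /w scalerA mulfV ?gt_eqF// scale1r addrC subrK.
have tn0 : \forall k \near \oo, t k != 0 by apply: nearW => k; rewrite gt_eqF.
pose y k := g (x k) - b k.
have yc : (fun k => (t k)^-1 *: (y k - g xbar)) @ \oo --> 'd g xbar xi.
  rewrite (_ : (fun k => _) = fun k =>
      (t k)^-1 *: (g (xbar + t k *: w k) - g xbar) - (t k)^-1 *: b k).
    rewrite -[X in _ --> X]subr0; apply: cvgB => //.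
    exact: cvg_difference_quotient.
  by apply/funext => k; rewrite -xE -scalerBr /y addrAC.
have yN k : normal_cone K (y k) (lambda k) by case: (kkt k).
have [Ch [nu [v [nuP vc nuc]]]] := normal_cone_sequence _ _ _ _ _ _ _ red mu_normal lbarE
  t y lambda _ Nlbar t0 tc yN yc lc.
set h := 'd g xbar xi in Ch vc nuc.
set q := curvature (g xbar) Xi mu h in nuc.
pose H := hessian (lagrangian f g lbar) xbar xi.
(* The value forced by dividing the difference of the two stationarity equations by [t k]. *)
pose z := - H - adjoint ('d g xbar) q.
have zc : (fun k => adjoint ('d g xbar) (nu k)) @ \oo --> z.
  apply: cvg_dotP => u.
  have phic : (fun k => (t k)^-1 *: ('d (lagrangian f g lbar) (x k) u -
      'd (lagrangian f g lbar) xbar u)) @ \oo --> dot H u.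
    rewrite /H dot_hessian_lagrangian//.
    have dL := differentiable_diff_lagrangian _ _ f_C2 g_C2 lbar xbar u.
    have /(_ _) := cvg_difference_quotient _ _ _ _ _ \oo _ _ _ dL tn0 tc wc.
    by under eq_fun do rewrite -/(w _) -xE.
  have dgc : (fun k => (t k)^-1 *: ('d g (x k) u - 'd g xbar u)) @ \oo --> diff2 g xbar u xi.
    have /(_ _) := cvg_difference_quotient _ _ _ _ _ \oo _ _ _ (d2g u) tn0 tc wc.
    by under eq_fun do rewrite -/(w _) -xE.
  have lc0 : (fun k => lambda k - lbar) @ \oo --> (0 : Y).
    by rewrite -[X in _ --> X](subrr lbar); apply: cvgB lc _; exact: cvg_cst.
  (* The third term vanishes in the limit: the quotient of ['d g] converges while [lambda k - lbar]
     tends to 0. *)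
  have E k : dot (adjoint ('d g xbar) (nu k)) u =
      dot ((t k)^-1 *: a k) u - (t k)^-1 *: ('d (lagrangian f g lbar) (x k) u -
      'd (lagrangian f g lbar) xbar u)
      - dot (lambda k - lbar) ((t k)^-1 *: ('d g (x k) u - 'd g xbar u))
      - dot ((t k)^-1 *: (lambda k - lbar) - nu k) ('d g xbar u).
    have [/= aE _] := kkt k.
    have := gradientP (lagrangian f g lbar) xbar u; rewrite gradL0 dot0l => <-.
    rewrite -aE dotZl gradientP adjointP !diff_lagrangian//.
    rewrite !(dotBl, dotZl, dotBr, dotZr) /GRing.scale/=.
    ring.
  rewrite (funext E) (_ : dot z u = 0 - dot H u - 0 - dot q ('d g xbar u)); last first.
    by rewrite /z -(sub0r H) !dotBl dot0l adjointP subr0.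
  apply: cvgB; last by apply: cvg_dot => //; exact: cvg_cst.
  apply: cvgB.
    apply: cvgB => //; rewrite -(dot0l u).
    by apply: cvg_dot => //; exact: cvg_cst.
  by rewrite -(dot0l (diff2 g xbar u xi)); exact: cvg_dot.
have [zeta Czeta zetaE] : (adjoint ('d g xbar) @` polar (critical_cone K (g xbar) lbar)) z.
  apply: (closed_cvg _ image_closed _ _ zc).
  by apply: filterS nuP => k [Pk _]; exists (nu k).
have stat : H + adjoint ('d g xbar) (zeta + q) = 0.
  apply: dot_inj => u; rewrite dotDl adjointP dotDl -!adjointP zetaE /z.
  rewrite -(sub0r H) !dotBl dot0l; ring.
have qE : q = 2^-1 *: gradient (Upsilon Xi (g xbar) mu) h.
  by rewrite (gradient_Upsilon _ _ _ _ _ _ red).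
(* Polarity gives one inequality, the sign hypothesis on Sigma and Gamma the other. *)
have hz : dot zeta h = 0.
  apply/eqP; rewrite eq_le Czeta//= dotC; apply: Sigma_Gamma; split => //.
  by rewrite /Sigma_set/= -qE.
have : [set xi | exists2 eta : Y,
     graphical_derivative (normal_cone K) (g xbar) lbar ('d g xbar xi) eta
     & hessian (lagrangian f g lbar) xbar xi + adjoint ('d g xbar) eta = 0] xi.
  by exists (zeta + q) => //; apply: (graphical_derivative_normal_cone _ U _ _ _ D).
by rewrite lbar_noncritical.
Qed.

End KKTLimit.

Theorem proposition4p2 (R : realType) (X Y : euclideanType R)
    (f : X -> R) (g : X -> Y) (K : set Y)
    (f_C2 : C2_on [set: X] f) (g_C2 : C2_on [set: X] g)
    (K_nonempty : K !=set0) (K_closed : closed K) (K_convex : convex_set K)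
    (K_reducible : C2_cone_reducible K)
    (xbar : X) (lbar : Y) (KKT : S_KKT f g K 0 0 (xbar, lbar))
    (* the data defining Upsilon *)
    (Z : euclideanType R) (U : set Y) (Xi : Y -> Z) (D : set Z)
    (reduction : C2_reduction K (g xbar) U Xi D)
    (mubar : Z) (mubar_normal : normal_cone D (Xi (g xbar)) mubar)
    (lbarE : lbar = adjoint ('d Xi (g xbar)) mubar)
    (Sigma_Gamma : forall xi zeta,
       (Sigma_set f g (Upsilon Xi (g xbar) mubar) xbar lbar
          `&` Gamma_set g K xbar lbar) (xi, zeta) ->
       0 <= dot ('d g xbar xi) zeta)
    (image_closed :
       closed (adjoint ('d g xbar) @` polar (critical_cone K (g xbar) lbar)))
    (lbar_noncritical : noncritical f g K xbar lbar) :
  pseudo_isolated_calm f g K xbar lbar.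
Proof.
apply: contrapT => notcalm.
pose e k : R := k.+1%:R^-1; have e0 k : 0 < e k by rewrite invr_gt0.
have ec : e @ \oo --> (0 : R) by exact: cvg_natSinv.
(* Calmness is denied with radii [1 / (k + 1)] and constant [k + 1]; [q] stores
   [((a, b), (x, lambda))]. *)
have /choice[s sP] k : exists q : (X * Y) * (X * Y),
    [/\ S_KKT f g K q.1.1 q.1.2 q.2,
        pair_norm (q.2.1 - xbar) (q.2.2 - lbar) <= e k &
        pair_norm q.1.1 q.1.2 < e k * `|q.2.1 - xbar|].
  apply: contrapT => no; apply: notcalm; exists (e k), (e k), (k.+1%:R); split=> //.
  move=> a b _ x lambda kkt xl; rewrite leNgt; apply/negP => lt.
  by apply: no; exists ((a, b), (x, lambda)); split=> //=; rewrite /e ltr_pdivlMl.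
pose t k := `|(s k).2.1 - xbar|.
(* The strict inequality, with a nonnegative left side, excludes [x = xbar]. *)
have t0 k : 0 < t k.
  have [_ _] := sP k; move/(le_lt_trans (sqrtr_ge0 _)).
  by rewrite pmulr_rgt0.
have small (V : euclideanType R) (c : nat -> V) (u : nat -> R) :
    (forall k, 0 < u k) -> (forall k, `|c k| <= e k * u k) ->
    (fun k => (u k)^-1 *: c k) @ \oo --> (0 : V).
  move=> u0 cu; apply/norm_cvg0P; apply: squeeze_cvgr (cvg_cst _) ec.
  apply: nearW => k; rewrite normr_ge0 normrZ ger0_norm ?invr_ge0 ?(ltW (u0 k))//=.
  by rewrite ler_pdivrMl// mulrC.
have te k : t k <= e k by have [_ + _] := sP k; apply: le_trans; exact: ler_pair_norml.
have tc : t @ \oo --> (0 : R).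
  apply: squeeze_cvgr (cvg_cst _) ec; apply: nearW => k.
  by rewrite te ltW.
have norm1 k : `|(t k)^-1 *: ((s k).2.1 - xbar)| = 1.
  by rewrite normrZ ger0_norm ?invr_ge0 ?(ltW (t0 k))// mulVf// gt_eqF.
have [|sg [xi [sgc xic]]] := bounded_subseq (fun k => (t k)^-1 *: ((s k).2.1 - xbar)) 1.
  by move=> k; rewrite norm1.
have xi0 : xi = 0.
  have lbarD v : dot lbar v = dot mubar ('d Xi (g xbar) v) by rewrite lbarE adjointP.
  apply: (KKT_limit_eq0 f g K f_C2 g_C2 K_closed K_convex xbar lbar U Xi D mubar lbarD
    KKT reduction mubar_normal Sigma_Gamma image_closed lbar_noncritical (t \o sg)
    (fun k => (s (sg k)).1.1) (fun k => (s (sg k)).2.1)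
    (fun k => (s (sg k)).1.2) (fun k => (s (sg k)).2.2)).
  - by move=> k; exact: t0.
  - exact: cvg_comp sgc tc.
  - apply: (cvg_comp _ _ sgc (small _ (fun k => (s k).1.1) t t0 _)) => k.
    by have [_ _ /ltW] := sP k; apply: le_trans; exact: ler_pair_norml.
  - apply: (cvg_comp _ _ sgc (small _ (fun k => (s k).1.2) t t0 _)) => k.
    by have [_ _ /ltW] := sP k; apply: le_trans; exact: ler_pair_normr.
  - apply: (cvg_comp _ _ sgc (_ : (fun k => (s k).2.2) @ \oo --> lbar)).
    apply/cvgrPdist_le => r r0; near=> k; rewrite distrC.
    have [_ + _] := sP k => /(le_trans (ler_pair_normr _ _ _ _ _))/le_trans; apply.
    by apply/ltW; near: k; exact: (near_infty_natSinv_lt (PosNum r0)).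
  - exact: xic.
  - by move=> k; case: (sP (sg k)); case: (s (sg k)).2.
(* The unit norms of the quotients converge to the norm of [xi], which is 0. *)
have c1 : (fun=> 1 : R) @ \oo --> (0 : R).
  rewrite -(normr0 X) -xi0.
  rewrite (_ : (fun=> 1) = fun k => `|(t (sg k))^-1 *: ((s (sg k)).2.1 - xbar)|).
    exact: cvg_norm xic.
  by apply/funext => k; rewrite norm1.
suff : (1 : R) = 0 by apply/eqP; rewrite oner_eq0.
have /(_ _) := cvg_lim (@Rhausdorff R) c1; rewrite lim_cst//; exact: Rhausdorff.
Unshelve. all: by end_near. Qed.
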